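(* Let $d > 1$ be an integer and let $\boldsymbol{\phi} = (\phi_1,\ldots,\phi_d): [-1,1] \to \mathbb{R}^d$ be a function. Let $x_1,\ldots,x_L \in [-1,1]$ be arbitrary points. Let $\boldsymbol{\Xi}$ be the $d \times [-1,1]$ quasimatrix whose $i$-th row is the function $\phi_i$, and let $\boldsymbol{\Psi} \in \mathbb{R}^{d \times L}$ be the matrix with entries $\boldsymbol{\Psi}_{i,l} = \phi_i(x_l)$. Let $s_1 \geq \cdots \geq s_d \geq 0$ and $\sigma_1 \geq \cdots \geq \sigma_d \geq 0$ be the singular values of $\boldsymbol{\Xi}$ and $\boldsymbol{\Psi}$, respectively. Then the following hold. 1. Suppose that for some $V > 0$ and some integer $\nu \geq 1$, and for every $1 \leq i \leq d$, the function $\phi_i$ and its derivatives through $\phi_i^{(\nu)}$ are absolutely continuous on $[-1,1]$ and $\phi_i^{(\nu)}$ is of bounded variation $V$. Then for every integer $j$ with $\nu + 1 < j \leq d-1$, $$ s_{j+1} \leq \frac{4V\sqrt{d}}{\pi \nu (j-1-\nu)^\nu} = \mathcal{O}(j^{-\nu}\sqrt{d}), \qquad \sigma_{j+1} \leq \frac{2V\sqrt{dL}}{\pi \nu (j-1-\nu)^\nu} = \mathcal{O}(j^{-\nu}\sqrt{dL}). $$ 2. Suppose that for some $M > 0$ and some $\rho > 1$, and for every $1 \leq i \leq d$, the function $\phi_i$ has an analytic continuation to the Bernstein ellipse of radius $\rho$ whose infinity norm there is no greater than $M$. Then for every integer $j$ with $0 \leq j \leq d-1$, $$ s_{j+1}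 \leq \frac{4M\sqrt{d}\,\rho^{-j+1}}{\rho - 1} = \mathcal{O}(\rho^{-j}\sqrt{d}), \qquad \sigma_{j+1} \leq \frac{2M\sqrt{dL}\,\rho^{-j+1}}{\rho-1} = \mathcal{O}(\rho^{-j}\sqrt{dL}). $$
   Context: A $d \times [-1,1]$ quasimatrix is a ''matrix'' with $d$ rows, each of which is a function on $[-1,1]$. Its singular values are those of the operator $L^2([-1,1]) \to \mathbb{R}^d$, $f \mapsto \left(\int_{-1}^1 \phi_i(x) f(x)\,dx\right)_{i=1}^d$; equivalently, the square roots of the eigenvalues of the $d\times d$ Gram matrix $\left(\int_{-1}^1 \phi_i\phi_{i'}\,dx\right)_{i,i'}$. If $L < d$, the list of singular values of $\boldsymbol{\Psi}$ is padded with zeros to length $d$. ''Of bounded variation $V$'' means having total variation at most $V$ on $[-1,1]$. The Bernstein ellipse of radius $\rho>1$ is the open region of the complex plane bounded by the ellipse $\{(z+z^{-1})/2 : |z| = \rho\}$ (foci $\pm 1$). The implied constants in the $\mathcal{O}$-notations depend only on $V,\nu$ in part 1 and only on $M,\rho$ in part 2. *)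

(* Defs.v *)
From mathcomp Require Import all_boot all_order all_algebra.
From mathcomp Require Import all_classical all_reals all_analysis.
From mathcomp Require Import complex.

Set Implicit Arguments.
Unset Strict Implicit.
Unset Printing Implicit Defensive.

Import Order.TTheory GRing.Theory Num.Theory.
Import numFieldNormedType.Exports.

Local Open Scope classical_set_scope.
Local Open Scope ring_scope.
Local Open Scope complex_scope.

(* The difference quotient is restricted to A, so for A = [a, b] the derivative
   is one-sided at a and b. *)
Definition derivative_on (R : realType) (A : set R) (f f' : R -> R) : Prop :=
  forall x, A x -> (fun y => (f y - f x) / (y - x)) @ within A x^' --> f' x.

Definition absolutely_continuous_on (R : realType) (A : set R) (f : R -> R) :
    Prop :=
  forall e : R, 0 < e -> exists2 delta : R, 0 < delta &
    forall (n : nat) (a b : 'I_n -> R),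
      (forall k, [/\ a k <= b k, A (a k) & A (b k)]) ->
      trivIset [set: 'I_n] (fun k => `]a k, b k[%classic) ->
      \sum_(k < n) (b k - a k) < delta ->
      \sum_(k < n) `|f (b k) - f (a k)| < e.

(* g k is the k-th derivative of f on [-1, 1] for k <= nu; all of g 0, ..., g nu
   are absolutely continuous and g nu has total variation at most V.  Values
   outside [-1, 1] are irrelevant. *)
Definition bv_smooth (R : realType) (nu : nat) (V : R) (f : R -> R) : Prop :=
  exists g : nat -> R -> R,
    [/\ {in `[-1, 1], g 0 =1 f},
        forall k, (k < nu)%N -> derivative_on `[-1, 1] (g k) (g k.+1),
        forall k, (k <= nu)%N -> absolutely_continuous_on `[-1, 1] (g k)
      & (total_variation (-1) 1 (g nu) <= V%:E)%E].

(* Stated over a generic numFieldType so that R[i] gets its norm topology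
   through the canonical instances on numFieldType. *)
Definition analytic_on (K : numFieldType) (U : set K) (F : K -> K) : Prop :=
  forall z0, U z0 -> exists2 r : K, 0 < r & exists c : nat -> K,
    forall z, `|z - z0| < r ->
      series (fun n => c n * (z - z0) ^+ n) @ \oo --> F z.

(* The ellipse {(z + z^-1) / 2 : |z| = rho} is centred at 0, so the open region
   it bounds consists of its multiples by the reals t in [0, 1[. *)
Definition bernstein_ellipse (R : realType) (rho : R) : set R[i] :=
  [set w | exists2 t : R, 0 <= t < 1 &
           exists2 z : R[i], `|z| = rho%:C & w = t%:C * ((z + z^-1) / 2)].

Definition bounded_analytic_continuation (R : realType) (rho M : R)
    (f : R -> R) : Prop :=
  exists F : R[i] -> R[i],
    [/\ analytic_on (bernstein_ellipse rho) F,
        {in `[-1, 1], forall x, F x%:C = (f x)%:C}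
      & forall w, bernstein_ellipse rho w -> `|F w| <= M%:C].

(* s lists, in nonincreasing order, the square roots of the eigenvalues of G
   counted with algebraic multiplicity. *)
Definition sqrt_eigenvalues (R : realType) (d : nat) (G : 'M[R]_d)
    (s : 'I_d -> R) : Prop :=
  [/\ forall i, 0 <= s i,
      forall i k : 'I_d, (i <= k)%N -> s k <= s i
    & char_poly G = \prod_(i < d) ('X - (s i ^+ 2)%:P)].

(* If T is the operator f |-> (\int phi_i f)_i from L^2([-1, 1]) to R^d, then
   T T^* is the Gram matrix below. *)
Definition quasimatrix_singular_values (R : realType) (d : nat)
    (phi : 'I_d -> R -> R) (s : 'I_d -> R) : Prop :=
  sqrt_eigenvalues
    (\matrix_(i < d, k < d)
       \int[lebesgue_measure]_(x in `[-1, 1]) (phi i x * phi k x)) s.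

(* Using the d x d matrix A A^T, the list has length d for every L: it is the
   list of the min(d, L) singular values of A, padded with zeros if L < d. *)
Definition matrix_singular_values (R : realType) (d L : nat)
    (A : 'M[R]_(d, L)) (s : 'I_d -> R) : Prop :=
  sqrt_eigenvalues (A *m A^T) s.

(* Main.v *)
(* If every phi_i is within B of a linear combination of j fixed functions, then
   on the common kernel of the coefficients, a space of codimension at most j,
   the Gram matrix is bounded by 2dB^2 and Psi Psi^T by dLB^2, so the min-max
   principle bounds the (j+1)-st singular values.  The combinations are the
   Chebyshev projections, i.e. the partial sums of the cosine series of
   phi_i(cos t); B is a bound for the tail of the coefficients a_k, the series
   converging to the function because a continuous function whose cosine
   moments all vanish is zero.
   In part 1, a_k(f) = (a_(k-1)(f') - a_(k+1)(f')) / (2k), and a summation by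
   parts bounds the coefficients of a function of variation V by 2V / (pi k).
   In part 2, a_k is a Laurent coefficient of F((z + 1/z) / 2), which may be
   computed on any circle of radius r < rho, hence is at most 2M / rho^k. *)
Require Import Defs.
From mathcomp Require Import all_boot all_order all_algebra.
From mathcomp Require Import all_classical all_reals all_analysis.
From mathcomp Require Import complex.
From mathcomp Require Import lra ring zify.

Set Implicit Arguments.
Unset Strict Implicit.
Unset Printing Implicit Defensive.

Import Order.TTheory GRing.Theory Num.Theory.
Import numFieldNormedType.Exports.
Import Normc.

Local Open Scope classical_set_scope.
Local Open Scope ring_scope.

(** * Singular values of nearly low-rank matrices *)

Section Spectral.
Local Open Scope sesquilinear_scope.

(** In part 1, k steps of the moment recurrence produce falling factorials, k (k-1) ... (k-nu) and
    not k^(nu+1). Their reciprocals telescope exactly, which gives the factor 1/nu; the power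
    (j-1-nu)^nu enters only afterwards, as a lower bound for (j-1) ... (j-nu). In part 2,
    analyticity is a local statement: a power series at each point of the open ellipse. The
    independence of the radius is therefore obtained by differentiating the circle integral in r.
    The Cauchy-Riemann equation turns a radial increment into an angular one, and an angular
    increment of a periodic function integrates to zero. This requires remainders that are uniform
    along the circle, hence a notion of holomorphy with a locally uniform quadratic remainder. Real
    parts of circle integrals suffice, since a cosine moment of a real function is one. The
    substitution x = cos t also removes the endpoints: cos never leaves [-1, 1], so one-sided
    derivatives at -1 and 1 become two-sided ones in t. *)

Lemma hermitian_spectral_form (C : numClosedFieldType) d (G U : 'M[C]_d)
    (D : 'rV[C]_d) (w : 'rV[C]_d) : U \is unitarymx ->
  G = invmx U *m diag_mx D *m U ->
  ((w *m U) *m G *m (w *m U)^t*) 0 0 = \sum_i D 0 i * `|w 0 i| ^+ 2 /\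
  ((w *m U) *m (w *m U)^t*) 0 0 = \sum_i `|w 0 i| ^+ 2.
Proof.
move=> uU ->; have Uu := unitarymx_unit uU.
rewrite trmx_mul map_mxM !mulmxA mulmxK //.
rewrite -[w *m diag_mx D *m U *m _]mulmxA -[w *m U *m _]mulmxA (unitarymxP uU).
rewrite !mulmx1; split; rewrite mxE; apply: eq_bigr => i _.
  by rewrite mul_mx_diag !mxE normCK mulrAC mulrC mulrA.
by rewrite !mxE normCK.
Qed.

(** [sqrt_eigenvalues] fixes its list only through the characteristic polynomial. Unique
    factorization into linear factors identifies that list, up to order, with the diagonal given by
    the spectral theorem. *)
Lemma similar_diag_perm (C : numClosedFieldType) d (G U : 'M[C]_d)
    (D : 'rV[C]_d) (t : 'I_d -> C) : U \in unitmx ->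
  G = invmx U *m diag_mx D *m U ->
  char_poly G = \prod_(i < d) ('X - (t i)%:P) ->
  perm_eq [seq D 0 i | i <- enum 'I_d] [seq t i | i <- enum 'I_d].
Proof.
move=> Uu GE cG.
have cD : char_poly G = \prod_(i < d) ('X - (D 0 i)%:P).
  transitivity (char_poly (diag_mx D)).
    rewrite /char_poly /char_poly_mx GE !map_mxM.
    have XE : ('X%:M : 'M[{poly C}]_d) = map_mx polyC (invmx U) *m 'X%:M *m map_mx polyC
      U.
      rewrite -scalemx1 -scalemxAr -scalemxAl mulmx1 -map_mxM mulVmx //.
      by rewrite map_mx1.
    rewrite [in LHS]XE -mulmxBl -mulmxBr !det_mulmx mulrAC -det_mulmx -map_mxM mulVmx
      //.
    by rewrite map_mx1 det1 mul1r.
  rewrite char_poly_trig; last exact/diag_mx_is_trig.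
  by apply: eq_bigr => i _; rewrite mxE eqxx mulr1n.
apply: prod_XsubC_eq.
by rewrite !big_map -!big_enum in cG cD *; rewrite -cG -cD.
Qed.

(** The eigenvectors with eigenvalue at least (s j)^2 span a space of dimension greater than j,
    hence greater than m, which must meet the kernel of P. At a nonzero common vector the quadratic
    form is at least (s j)^2 and at most e^2 times the squared norm. The spectral theorem is applied
    over R[i], so this vector is complex. *)
Lemma sqrt_eigenvalues_le (R : realType) d m (G : 'M[R]_d) (s : 'I_d -> R)
    (P : 'M[R]_(d, m)) (e : R) : G^T = G -> sqrt_eigenvalues G s -> 0 <= e ->
  (forall v : 'rV[R]_d, v *m P = 0 ->
     (v *m G *m v^T) 0 0 <= e ^+ 2 * \sum_i v 0 i ^+ 2) ->
  forall j : 'I_d, (m <= j)%N -> s j <= e.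
Proof.
move=> Gsym [s_ge0 s_dec cG] e0 GP j mj.
pose rc := real_complex R; pose Gc := map_mx rc G.
have Gn : Gc \is normalmx.
  apply: symmetric_normalmx; last first.
    by apply/mxOverP => i k; rewrite mxE complex_real.
  by apply/is_hermitianmxP; apply/matrixP => i k;
    rewrite expr0 scale1r !mxE -[G in LHS]Gsym mxE.
have uU := spectral_unitarymx Gc.
have GE := (orthomx_spectralP Gn).
set U := spectralmx Gc in uU GE; set D := spectral_diag Gc in GE.
have Dperm : perm_eq [seq D 0 i | i <- enum 'I_d]
    [seq rc (s i ^+ 2) | i <- enum 'I_d].
  apply: (similar_diag_perm (unitarymx_unit uU) GE).
  rewrite -map_char_poly cG rmorph_prod /=; apply: eq_bigr => i _.
  by rewrite rmorphB /= map_polyX map_polyC.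
(* The diagonal D is known only up to a permutation. The cardinality of S is insensitive to it, and
   the indices i <= j already contribute j + 1 elements. *)
pose S := [set i | rc (s j ^+ 2) <= D 0 i]%SET.
have card_count (Q : pred 'I_d) : count Q (enum 'I_d) = #|[set i | Q i]%SET|.
  by rewrite cardsE cardE -size_filter enumT.
have jS : (j < #|S|)%N.
  rewrite -card_count -(count_map (fun i => D 0 i) (fun x => rc (s j ^+ 2) <= x)).
  rewrite (permP Dperm) count_map card_count.
  have -> : [set i | preim (fun i => rc (s i ^+ 2)) (fun x => rc (s j ^+ 2) <= x) i]%SET
      = [set i | s j ^+ 2 <= s i ^+ 2]%SET.
    by apply/setP => i; rewrite !inE /= lecR.
  have : (#|[set i : 'I_d | (i <= j)%N]%SET|
    <= #|[set i | (s j ^+ 2 <= s i ^+ 2)%R]%SET|)%N.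
    apply: subset_leq_card; apply/fintype.subsetP => i; rewrite !inE => ij.
    by rewrite lerXn2r ?nnegrE ?s_dec.
  apply: leq_trans; rewrite -[X in (X <= _)%N]card_ord.
  have winj : injective (widen_ord (ltn_ord j)) by move=> k l /(congr1 val) /= /val_inj.
  rewrite -(card_imset _ winj).
  by apply: subset_leq_card; apply/fintype.subsetP => k /imsetP[i _ ->];
    rewrite inE /= -ltnS.
pose f (k : 'I_#|S|) : 'I_d := enum_val k.
pose E : 'M[R[i]]_(#|S|, d) := rowsub f 1%:M.
(* A matrix with #|S| > m rows and m columns has a nonzero left kernel. *)
have [c c_neq0 cP] : exists2 c : 'rV[R[i]]_#|S|,
    c != 0 & c *m (E *m U *m map_mx rc P) = 0.
  have: kermx (E *m U *m map_mx rc P) != 0.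
    rewrite kermx_eq0 /row_free; apply: contraTneq jS => rE.
    by rewrite -rE -leqNgt (leq_trans (rank_leq_col _)).
  case/rowV0Pn => c /sub_kermxP cP c0; by exists c.
pose w := c *m E; pose v := w *m U.
have [vG vv] := hermitian_spectral_form w uU GE.
have w_out i : i \notin S -> w 0 i = 0.
  move=> iS; rewrite mxE big1 // => k _; rewrite !mxE /f.
  have [ki|_] := eqVneq; last by rewrite mulr0.
  by rewrite -ki enum_valP in iS.
have w_neq0 : exists i, w 0 i != 0.
  have /rV0Pn[k ck] := c_neq0; exists (f k); rewrite mxE (bigD1 k) //= big1.
    by rewrite !mxE eqxx mulr1 addr0.
  by move=> l lk; rewrite !mxE (inj_eq enum_val_inj) (negPf lk) mulr0.
have lower : rc (s j ^+ 2) * \sum_i `|w 0 i| ^+ 2 <= \sum_i D 0 i * `|w 0 i| ^+ 2.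
  rewrite mulr_sumr; apply: ler_sum => i _.
  have [iS|/w_out ->] := boolP (i \in S); last by rewrite normr0 expr0n !mulr0.
  by apply: ler_wpM2r; rewrite ?exprn_ge0 //; rewrite inE in iS.
have vP : v *m map_mx rc P = 0 by rewrite -cP /v /w !mulmxA.
rewrite -/v in vG vv; rewrite -vv -vG in lower; clearbody v.
(* P and G are real and G is symmetric, so the real and imaginary parts of v both lie in the kernel
   of P, and the Hermitian form at v is the sum of the real forms at the two parts. *)
pose a : 'rV[R]_d := \row_i complex.Re (v 0 i);
  pose b : 'rV[R]_d := \row_i complex.Im (v 0 i).
have Re_sum (I : finType) (F : I -> R[i]) : complex.Re (\sum_i F i)
  = \sum_i complex.Re (F i).
  by apply: (big_morph (@complex.Re R)) => // -[? ?] [? ?].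
have Im_sum (I : finType) (F : I -> R[i]) : complex.Im (\sum_i F i)
  = \sum_i complex.Im (F i).
  by apply: (big_morph (@complex.Im R)) => // -[? ?] [? ?].
have ReM x y : complex.Re (x * rc y) = complex.Re x * y.
  by case: x => ? ? /=; rewrite mulr0 subr0.
have ImM x y : complex.Im (x * rc y) = complex.Im x * y.
  by case: x => ? ? /=; rewrite mulr0 add0r.
have aP : a *m P = 0.
  apply/rowP => k; have /rowP/(_ k)/(congr1 (@complex.Re R)) := vP.
  rewrite !mxE Re_sum => H; rewrite -[RHS]H; apply: eq_bigr => i _; by rewrite !mxE ReM.
have bP : b *m P = 0.
  apply/rowP => k; have /rowP/(_ k)/(congr1 (@complex.Im R)) := vP.
  rewrite !mxE Im_sum => H; rewrite -[RHS]H; apply: eq_bigr => i _; by rewrite !mxE ImM.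
have ReG : complex.Re ((v *m Gc *m v^t*) 0 0) = (a *m G *m a^T) 0 0
  + (b *m G *m b^T) 0 0.
  rewrite !mxE Re_sum -big_split /=; apply: eq_bigr => k _.
  rewrite !mxE !mulr_suml Re_sum -big_split; apply: eq_bigr => i _ /=.
  by rewrite !mxE; case: (v 0 i) (v 0 k) => [? ?] [? ?] /=; ring.
have ReV : complex.Re ((v *m v^t*) 0 0) = \sum_i a 0 i ^+ 2 + \sum_i b 0 i ^+ 2.
  rewrite !mxE Re_sum -big_split /=; apply: eq_bigr => k _.
  by rewrite !mxE; case: (v 0 k) => [? ?] /=; ring.
have T_gt0 : 0 < complex.Re ((v *m v^t*) 0 0).
  have : 0 < (v *m v^t*) 0 0.
    have [i wi] := w_neq0; rewrite vv (bigD1 i) //=; apply: ltr_wpDr.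
      by apply: sumr_ge0 => ? _; rewrite exprn_ge0.
    by rewrite exprn_gt0 // normr_gt0.
  by rewrite ltcE => /andP[].
have {}lower : s j ^+ 2 * complex.Re ((v *m v^t*) 0 0)
  <= complex.Re ((v *m Gc *m v^t*) 0 0).
  by move: lower; rewrite lecE => /andP[_]; rewrite mulrC ReM mulrC.
have upper : complex.Re ((v *m Gc *m v^t*) 0 0) <= e ^+ 2
  * complex.Re ((v *m v^t*) 0 0).
  by rewrite ReG ReV mulrDr lerD ?GP.
have := le_trans lower upper; rewrite ler_pM2r //.
by rewrite ler_sqr // nnegrE.
Qed.

End Spectral.

(** Cauchy-Schwarz from Lagrange's identity: twice the defect is the double sum of the squares (a_i
    b_k - a_k b_i)^2. *)
Lemma sum_mul_sqr_le (R : realDomainType) (I : finType) (a b : I -> R) :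
  (\sum_i a i * b i) ^+ 2 <= (\sum_i a i ^+ 2) * \sum_i b i ^+ 2.
Proof.
have : 0 <= \sum_i \sum_k (a i * b k - a k * b i) ^+ 2.
  by apply: sumr_ge0 => i _; apply: sumr_ge0 => k _; rewrite sqr_ge0.
have -> : \sum_i \sum_k (a i * b k - a k * b i) ^+ 2
    = 2 * ((\sum_i a i ^+ 2) * (\sum_i b i ^+ 2) - (\sum_i a i * b i) ^+ 2).
  transitivity (\sum_i \sum_k (a i ^+ 2 * b k ^+ 2 + a k ^+ 2 * b i ^+ 2
      - 2 * (a i * b i) * (a k * b k))).
    by apply: eq_bigr => i _; apply: eq_bigr => k _; ring.
  under eq_bigr => i _ do rewrite sumrB big_split /= -mulr_sumr -mulr_suml -mulr_sumr.
  rewrite sumrB big_split /= -mulr_suml -mulr_sumr -mulr_suml -mulr_sumr; ring.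
by rewrite pmulr_rge0 // subr_ge0.
Qed.

Section RintegralContinuous.
Variables (R : realType) (a b : R).
Notation mu := (@lebesgue_measure R).

Lemma integrable_segment (f : R -> R) : {within `[a, b], continuous f} ->
  mu.-integrable `[a, b] (EFin \o f).
Proof. exact/continuous_compact_integrable/segment_compact. Qed.

Lemma Rintegral_sum (I : finType) (f : I -> R -> R) :
  (forall i, {within `[a, b], continuous f i}) ->
  \int[mu]_(x in `[a, b]) (\sum_i f i x) = \sum_i \int[mu]_(x in `[a, b]) f i x.
Proof.
move=> cf; rewrite /Rintegral; under eq_integral do rewrite -sumEFin.
rewrite integral_sum //; last by move=> i; exact: integrable_segment.
rewrite sum_fine // => i _; apply: integrable_fin_num => //.
exact: integrable_segment.
Qed.

End RintegralContinuous.

Lemma continuous_mul (T : topologicalType) (R : realType) (f g : T -> R) :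
  continuous f -> continuous g -> continuous (fun x => f x * g x).
Proof. by move=> cf cg x; apply: continuousM; [exact: cf|exact: cg]. Qed.

Lemma continuous_scale (T : topologicalType) (R : realType) (c : R) (f : T -> R) :
  continuous f -> continuous (fun x => c * f x).
Proof. by apply: continuous_mul => x; exact: cst_continuous. Qed.

Lemma continuous_sum (T : topologicalType) (R : realType) (I : finType)
    (f : I -> T -> R) :
  (forall i, continuous (f i)) -> continuous (fun x => \sum_i f i x).
Proof.
move=> cf x; apply: cvg_big; first exact: add_continuous.
by move=> i _; exact: cf.
Qed.
Arguments continuous_sum {T R I}.

Lemma gram_form (R : realType) d (phi : 'I_d -> R -> R) (v : 'rV[R]_d) :
  (forall i, {within `[-1, 1], continuous phi i}) ->
  (v *m (\matrix_(i < d, k < d)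
     \int[lebesgue_measure]_(x in `[-1, 1]) (phi i x * phi k x)) *m v^T) 0 0
  = \int[lebesgue_measure]_(x in `[-1, 1]) ((\sum_i v 0 i * phi i x) ^+ 2).
Proof.
move=> cphi.
have cvv i k : {within `[-1, 1],
  continuous (fun x => v 0 i * v 0 k * (phi i x * phi k x))}.
  by apply: continuous_scale; apply: continuous_mul; exact: cphi.
transitivity (\int[lebesgue_measure]_(x in `[-1, 1])
    (\sum_k \sum_i v 0 i * v 0 k * (phi i x * phi k x))); last first.
  apply: eq_Rintegral => x _; rewrite expr2 mulr_suml exchange_big.
  apply: eq_bigr => i _; rewrite mulr_sumr; apply: eq_bigr => k _ /=; ring.
rewrite Rintegral_sum; last by move=> k; apply: continuous_sum => i; exact: cvv.
rewrite mxE; apply: eq_bigr => k _; rewrite Rintegral_sum //.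
rewrite !mxE mulr_suml; apply: eq_bigr => i _; rewrite !mxE RintegralZl //.
  by rewrite mulrAC.
by apply: integrable_segment; apply: continuous_mul; exact: cphi.
Qed.

Section LowRankApproximation.
Variables (R : realType) (d m : nat) (phi : 'I_d -> R -> R).
Variables (T : 'I_m -> R -> R) (P : 'M[R]_(d, m)) (B : R).
Hypothesis approx : forall i x, x \in `[-1, 1] ->
  `|phi i x - \sum_k P i k * T k x| <= B.

(** On the kernel of P the approximants cancel from the combination, so each phi i can be replaced
    by its remainder, of size at most B, before applying Cauchy-Schwarz. *)
Lemma kernel_form_le (v : 'rV[R]_d) x : x \in `[-1, 1] -> v *m P = 0 ->
  (\sum_i v 0 i * phi i x) ^+ 2 <= d%:R * B ^+ 2 * \sum_i v 0 i ^+ 2.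
Proof.
move=> x11 vP.
have -> : \sum_i v 0 i * phi i x
    = \sum_i v 0 i * (phi i x - \sum_k P i k * T k x).
  under [RHS]eq_bigr do rewrite mulrBr.
  rewrite sumrB [X in _ - X](_ : _ = 0) ?subr0 //.
  under eq_bigr do rewrite mulr_sumr.
  rewrite exchange_big /= big1 // => k _.
  have /rowP/(_ k) := vP; rewrite !mxE => vPk.
  under eq_bigr do rewrite mulrA.
  by rewrite -mulr_suml vPk mul0r.
apply: le_trans (sum_mul_sqr_le _ _) _; rewrite mulrC.
apply: ler_wpM2r; first by apply: sumr_ge0 => i _; exact: sqr_ge0.
have -> : d%:R * B ^+ 2 = \sum_(i < d) B ^+ 2.
  by rewrite sumr_const card_ord mulr_natl.
apply: ler_sum => i _; rewrite -[leLHS]ger0_norm ?sqr_ge0 // normrX ler_sqr ?approx //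
  nnegrE //.
exact: le_trans (normr_ge0 _) (approx i x11).
Qed.

Lemma matrix_singular_values_le L (x : 'I_L -> R) (sigma : 'I_d -> R) :
  0 <= B -> (forall l, x l \in `[-1, 1]) ->
  matrix_singular_values (\matrix_(i < d, l < L) phi i (x l)) sigma ->
  forall j : 'I_d, (m <= j)%N -> sigma j <= Num.sqrt (d * L)%:R * B.
Proof.
move=> B0 x11 sv j mj; set A := \matrix_(i, l) _ in sv.
apply: (sqrt_eigenvalues_le (P := P) _ sv) mj.
- by rewrite trmx_mul trmxK.
- by rewrite mulr_ge0 // sqrtr_ge0.
move=> v vP; rewrite exprMn sqr_sqrtr // mulmxA -mulmxA -trmx_mul.
have -> : ((v *m A) *m (v *m A)^T) 0 0 = \sum_l (\sum_i v 0 i * phi i (x l)) ^+ 2.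
  rewrite mxE; apply: eq_bigr => l _; rewrite !mxE expr2.
  by congr (_ * _); apply: eq_bigr => i _; rewrite !mxE.
apply: (@le_trans _ _ (\sum_(l < L) d%:R * B ^+ 2 * \sum_i v 0 i ^+ 2)).
  by apply: ler_sum => l _; exact: kernel_form_le.
by rewrite sumr_const card_ord -[leLHS]mulr_natl natrM !mulrA [L%:R * _]mulrC.
Qed.

Lemma quasimatrix_singular_values_le (s : 'I_d -> R) :
  0 <= B -> (forall i, {within `[-1, 1], continuous phi i}) ->
  quasimatrix_singular_values phi s ->
  forall j : 'I_d, (m <= j)%N -> s j <= 2 * Num.sqrt d%:R * B.
Proof.
move=> B0 cphi sv j mj.
apply: (sqrt_eigenvalues_le (P := P) _ sv) mj.
- apply/matrixP => i k; rewrite !mxE; apply: eq_Rintegral => x _; exact: mulrC.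
- by rewrite !mulr_ge0 // sqrtr_ge0.
move=> v vP; rewrite gram_form //.
set c := d%:R * B ^+ 2 * \sum_i v 0 i ^+ 2.
have c0 : 0 <= c by rewrite !mulr_ge0 ?sqr_ge0 // sumr_ge0 // => i _; exact: sqr_ge0.
apply: (@le_trans _ _ (\int[lebesgue_measure]_(x in `[(-1)%R, 1%R]) c)).
  apply: le_Rintegral => //.
  - apply: integrable_segment.
    have -> : (fun x => (\sum_i v 0 i * phi i x) ^+ 2)
      = (fun x => (\sum_i v 0 i * phi i x) * (\sum_i v 0 i * phi i x)).
      by apply/funext => x; rewrite expr2.
    have cs : {within `[-1, 1], continuous (fun x => \sum_i v 0 i * phi i x)}.
      by apply: continuous_sum => i; apply: continuous_scale; exact: cphi.
    exact: continuous_mul.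
  - by apply: integrable_segment; apply: continuous_subspaceT; exact: cst_continuous.
  - by move=> x x11; exact: kernel_form_le.
(* The length 2 of the interval yields 2 c, while the claim allows 4 c: rounding sqrt 2 up to 2 is
   what makes the bound for s carry 4 where the one for sigma carries 2. *)
rewrite Rintegral_cst //.
have -> : fine (lebesgue_measure (`[-1, 1]%classic : set R)) = 2.
  by rewrite lebesgue_measure_itv /= lte_fin ifT /=; lra.
rewrite !exprMn sqr_sqrtr // /c in c0 *; nra.
Qed.

End LowRankApproximation.

(** * Integrals of continuous functions over a segment *)

Section Derive.
Variable R : realType.
Implicit Types (f g : R -> R) (a b c x : R).

Lemma is_derive_mul f g x a b : is_derive x 1 f a -> is_derive x 1 g b ->
  is_derive x 1 (fun y => f y * g y) (f x * b + g x * a).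
Proof. by move=> df dg; exact: is_deriveM. Qed.

Lemma is_derive_comp f g x a b : is_derive (g x) 1 f a -> is_derive x 1 g b ->
  is_derive x 1 (fun y => f (g y)) (a * b).
Proof. by move=> df dg; exact: is_derive1_comp. Qed.

Lemma is_derive_scale f c x a : is_derive x 1 f a ->
  is_derive x 1 (fun y => c * f y) (c * a).
Proof.
move=> df; have -> : c * a = c * a + f x * 0 by ring.
by apply: is_derive_mul; exact: is_derive_cst.
Qed.

Lemma is_derive_add f g x a b : is_derive x 1 f a -> is_derive x 1 g b ->
  is_derive x 1 (fun y => f y + g y) (a + b).
Proof. by move=> df dg; exact: is_deriveD. Qed.

Lemma is_derive_sub f g x a b : is_derive x 1 f a -> is_derive x 1 g b ->
  is_derive x 1 (fun y => f y - g y) (a - b).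
Proof. by move=> df dg; exact: is_deriveB. Qed.

Lemma is_derive_linear c x : is_derive x 1 (fun y => c * y) c.
Proof. by rewrite -[X in is_derive _ _ _ X]mulr1; apply: is_derive_scale;
  exact: is_derive_id. Qed.

Lemma is_derive_cosM c x : is_derive x 1 (fun y => cos (c * y)) (- sin (c * x) * c).
Proof. exact: (is_derive_comp (is_derive_cos _) (is_derive_linear _ _)). Qed.

Lemma is_derive_sinM c x : is_derive x 1 (fun y => sin (c * y)) (cos (c * x) * c).
Proof. exact: (is_derive_comp (is_derive_sin _) (is_derive_linear _ _)). Qed.

Lemma is_derive_continuous f x a : is_derive x 1 f a -> {for x, continuous f}.
Proof. by case=> df _; apply/differentiable_continuous/derivable1_diffP. Qed.

Lemma continuous_cosM c : continuous (fun x : R => cos (c * x)).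
Proof. by move=> x; exact: is_derive_continuous (is_derive_cosM c x). Qed.

End Derive.

Definition segint (R : realType) (a b : R) (f : R -> R) : R :=
  \int[lebesgue_measure]_(x in `[a, b]) f x.

Section Segint.
Variable R : realType.
Implicit Types (f g F : R -> R) (a b c x A M : R).

Lemma segint_integrable a b f : continuous f ->
  lebesgue_measure.-integrable `[a, b] (EFin \o f).
Proof. by move=> cf; apply: integrable_segment; exact: continuous_subspaceT. Qed.

Lemma segint_FTC a b f F : a < b -> continuous f ->
  (forall x, a <= x <= b -> is_derive x 1 F (f x)) -> segint a b f = F b - F a.
Proof.
move=> ab cf dF; rewrite /segint /Rintegral (@continuous_FTC2 _ _ F) //.
- exact: continuous_subspaceT.
- split.
  + by move=> x; rewrite in_itv /= => /andP[ax xb]; case: (dF x _) => //; rewrite !ltW.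
  + apply: cvg_at_right_filter; apply: is_derive_continuous (dF a _).
    by rewrite lexx ltW.
  + apply: cvg_at_left_filter; apply: is_derive_continuous (dF b _).
    by rewrite lexx ltW.
- move=> x; rewrite in_itv /= => /andP[ax xb]; rewrite derive1E.
  by case: (dF x _) => //; rewrite !ltW.
Qed.

(** Starting the integral at -A, outside the segment of interest, gives two-sided derivatives at the
    ends of that segment as well. *)
Lemma antiderivative_exists f A : continuous f ->
  exists F, forall x, `|x| < A -> is_derive x 1 F (f x).
Proof.
move=> cf; exists (fun x => segint (- A) x f) => x; rewrite ltr_norml => /andP[Ax xA].
have [|dF F'] := @continuous_FTC1_closed R f (- A) x A xA (segint_integrable _ _ cf) Ax.
  exact: cf.
by split=> //; rewrite -derive1E.
Qed.

Lemma segint_cst a b c : a <= b -> segint a b (fun=> c) = c * (b - a).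
Proof.
move=> ab; rewrite /segint Rintegral_cst //.
have -> : fine (lebesgue_measure (`[a, b]%classic : set R)) = b - a.
  rewrite lebesgue_measure_itv /= lte_fin; case: ltgtP ab => //= -> _.
  by rewrite subrr.
by [].
Qed.

Lemma segintD a b f g : continuous f -> continuous g ->
  segint a b (fun x => f x + g x) = segint a b f + segint a b g.
Proof. by move=> cf cg; apply: RintegralD => //; exact: segint_integrable. Qed.

Lemma segintB a b f g : continuous f -> continuous g ->
  segint a b (fun x => f x - g x) = segint a b f - segint a b g.
Proof. by move=> cf cg; apply: RintegralB => //; exact: segint_integrable. Qed.

Lemma segintZ a b c f : continuous f ->
  segint a b (fun x => c * f x) = c * segint a b f.
Proof. by move=> cf; apply: RintegralZl => //; exact: segint_integrable. Qed.

Lemma segint_sum (I : finType) a b (f : I -> R -> R) : (forall i, continuous (f i)) ->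
  segint a b (fun x => \sum_i f i x) = \sum_i segint a b (f i).
Proof. by move=> cf; apply: Rintegral_sum => i; exact: continuous_subspaceT. Qed.

Lemma eq_segint a b f g : (forall x, a <= x <= b -> f x = g x) ->
  segint a b f = segint a b g.
Proof. by move=> fg; apply: eq_Rintegral => x; rewrite inE /= in_itv /=; exact: fg. Qed.

Lemma le_segint a b f g : continuous f -> continuous g ->
  (forall x, a <= x <= b -> f x <= g x) -> segint a b f <= segint a b g.
Proof.
by move=> cf cg fg; apply: le_Rintegral => //; exact: segint_integrable.
Qed.

Lemma segint_norm_le a b f M : a <= b -> continuous f ->
  (forall x, a <= x <= b -> `|f x| <= M) -> `|segint a b f| <= M * (b - a).
Proof.
move=> ab cf fM; have cst c : continuous (fun _ : R => c) by move=> x;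
  exact: cst_continuous.
rewrite ler_norml -mulNr -!segint_cst //.
by apply/andP; split; apply: le_segint => // x /fM; rewrite ler_norml => /andP[].
Qed.

(** An antiderivative is nondecreasing and takes the same value at both ends, so it is constant and
    its derivative vanishes. *)
Lemma segint_ge0_eq0 a b f x : continuous f -> (forall x, a <= x <= b -> 0 <= f x) ->
  segint a b f <= 0 -> a < x < b -> f x = 0.
Proof.
move=> cf f0 If /andP[ax xb]; have ab := lt_trans ax xb.
have [F dF] := antiderivative_exists (`|a| + `|b| + 1) cf.
have dF' y : a <= y <= b -> is_derive y 1 F (f y).
  move=> /andP[ay yb]; apply: dF; have := ler_norm b; have := ler_norm (- a).
  by have := normr_ge0 a; have := normr_ge0 b; rewrite normrN ltr_norml; lra.
have F_mono y z : a <= y -> y <= z -> z <= b -> F y <= F z.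
  move=> ay yz zb; have [||c] := @MVT_segment R F f y z yz.
  - move=> c; rewrite in_itv /= => /andP[? ?]; apply: dF'; lra.
  - apply: derivable_within_continuous => c; rewrite in_itv /= => /andP[? ?].
    by case: (dF' c) => //; lra.
  rewrite in_itv /= => /andP[? ?] /eqP; rewrite subr_eq => /eqP ->.
  rewrite lerDr mulr_ge0 ?subr_ge0 // f0 //; lra.
have FE y : a <= y <= b -> F y = F a.
  move=> /andP[ay yb]; apply/eqP; rewrite eq_le; apply/andP; split; last exact: F_mono.
  apply: le_trans (F_mono _ _ ay yb (lexx _)) _.
  by rewrite -subr_le0 -(segint_FTC ab cf dF').
have dFx : is_derive x 1 F (f x) by apply: dF'; rewrite !ltW.
rewrite -(@derive_val _ _ _ _ _ _ _ dFx) -(@derive_val _ _ _ x 1 (fun=> F a) 0 _).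
apply: near_eq_derive.
near=> y; apply: FE; apply/andP; split; apply: ltW; near: y.
  exact: lt_nbhsr.
exact: lt_nbhsl.
Unshelve. all: by end_near. Qed.

End Segint.

(** * Cosine series *)

Section CosineUniqueness.
Variable R : realType.
Implicit Types (h q : R -> R) (t : R).

Lemma sin_natpi (k : nat) : sin (k%:R * pi) = 0 :> R.
Proof.
elim: k => [|k IH]; first by rewrite mul0r sin0.
by rewrite -natr1 mulrDl mul1r sinDpi IH oppr0.
Qed.

Lemma cosM_cosM t (a b : R) :
  cos (a * t) * cos (b * t) = 2^-1 * (cos ((a - b) * t) + cos ((a + b) * t)).
Proof. by rewrite mulrBl mulrDl cosB cosD; field. Qed.

Lemma segint_cosM (k m : nat) :
  segint 0 pi (fun t : R => cos ((k%:R - m%:R) * t)) = if k == m then pi else 0.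
Proof.
case: eqVneq => [->|km].
  rewrite subrr (_ : (fun t => _) = (fun=> 1)); last first.
    by apply/funext => t; rewrite mul0r cos0.
  by rewrite segint_cst ?pi_ge0 // subr0 mul1r.
have c0 : k%:R - m%:R != 0 :> R by rewrite subr_eq0 eqr_nat.
have dF x : 0 <= x <= pi -> is_derive x 1
    (fun t => (k%:R - m%:R)^-1 * sin ((k%:R - m%:R) * t)) (cos ((k%:R - m%:R) * x)).
  move=> _; have -> : cos ((k%:R - m%:R) * x) =
      (k%:R - m%:R)^-1 * (cos ((k%:R - m%:R) * x) * (k%:R - m%:R)).
    by rewrite mulrCA mulVf ?mulr1.
  exact/is_derive_scale/is_derive_sinM.
rewrite (segint_FTC (pi_gt0 R) _ dF); last exact: continuous_cosM.
by rewrite mulr0 sin0 mulr0 subr0 mulrBl sinB !sin_natpi mul0r mulr0 subrr mulr0.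
Qed.

Lemma cos_lipschitz t u : `|cos t - cos u| <= `|t - u|.
Proof.
wlog le_tt : t u / t <= u.
  by move=> H; case: (leP t u) => [|/ltW] /H //; rewrite distrC [leRHS]distrC.
have [|c _] := @MVT_segment R cos (fun x => - sin x) t u le_tt.
by apply: continuous_subspaceT; exact: continuous_cos.
rewrite distrC => ->; rewrite normrM [leRHS]distrC.
by rewrite ler_piMl // normrN sin_max.
Qed.

Lemma continuous_add (T : topologicalType) (f g : T -> R) :
  continuous f -> continuous g -> continuous (fun x => f x + g x).
Proof. by move=> cf cg x; apply: continuousD; [exact: cf|exact: cg]. Qed.

Lemma continuous_sub (T : topologicalType) (f g : T -> R) :
  continuous f -> continuous g -> continuous (fun x => f x - g x).
Proof. by move=> cf cg x; apply: continuousB; [exact: cf|exact: cg]. Qed.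

Definition cos_orthogonal q :=
  forall k : nat, segint 0 pi (fun t => q t * cos (k%:R * t)) = 0.

Lemma cos_orthogonal_sub (c e : R) q r : continuous q -> continuous r ->
  cos_orthogonal q -> cos_orthogonal r ->
  cos_orthogonal (fun t => c * q t - e * r t).
Proof.
move=> cq cr oq or k; have cck := @continuous_cosM R k%:R.
transitivity (segint 0 pi (fun t => c * (q t * cos (k%:R * t)) - e
  * (r t * cos (k%:R * t)))).
  by apply: eq_segint => t _; ring.
rewrite segintB; try by apply: continuous_scale; exact: continuous_mul.
rewrite !segintZ; try exact: continuous_mul.
by rewrite oq or !mulr0 subrr.
Qed.

Lemma cos_orthogonal_cos q : continuous q ->
  cos_orthogonal q -> cos_orthogonal (fun t => q t * cos t).
Proof.
move=> cq oq k.
pose s (k : nat) t := q t * cos (k%:R * t).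
have cs l : continuous (s l) by apply: continuous_mul => //; exact: continuous_cosM.
(* The product of cos t and cos kt is the mean of the cosines of index k - 1 and k + 1; for k = 0
   the index -1 is replaced by 1, cosine being even. *)
transitivity (segint 0 pi
  (fun t => 2^-1 * (s (if k is l.+1 then l else 1%N) t + s k.+1 t))).
  apply: eq_segint => t _; rewrite -mulrA -[X in cos X * _]mul1r [cos _ * _]mulrC
    cosM_cosM.
  rewrite natr1 /s -mulrDr; case: k => [|l].
    by rewrite sub0r mulNr cosN; ring.
  have -> : l.+1%:R - 1 = l%:R :> R by rewrite -natr1 addrK.
  by ring.
rewrite segintZ; last exact: continuous_add.
by rewrite segintD // !oq addr0 mulr0.
Qed.

(** Orthogonality survives multiplication by cos t, hence by any polynomial in cos t. The powers
    considered here are those of a kernel peaked where cos t = c. *)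
Lemma cos_orthogonal_pow h (a b c : R) (n : nat) : continuous h ->
  cos_orthogonal h ->
  cos_orthogonal (fun t => h t * (a - b * (cos t - c) ^+ 2) ^+ n).
Proof.
move=> ch oh; elim: n => [|n IH].
  by move=> k; rewrite -[RHS](oh k); apply: eq_segint => t _; rewrite expr0 mulr1.
set q := fun t => _ in IH.
have cq : continuous q.
  apply: continuous_mul => //; elim: n {IH q} => [|n IH].
    by move=> x; exact: cst_continuous.
  under eq_fun do rewrite exprS; apply: continuous_mul => //.
  apply: continuous_sub; first by move=> x; exact: cst_continuous.
  apply: continuous_scale; under eq_fun do rewrite expr2.
  by apply: continuous_mul; apply: continuous_sub => x; [exact: continuous_cos|
    exact: cst_continuous|exact: continuous_cos|exact: cst_continuous].
have cqc : continuous (fun t => q t * cos t) by apply: continuous_mul => //;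
  exact: continuous_cos.
have cqcc : continuous (fun t => q t * cos t * cos t) by apply: continuous_mul => //;
  exact: continuous_cos.
have o1 := cos_orthogonal_cos cq IH.
have o2 := cos_orthogonal_cos cqc o1.
have := cos_orthogonal_sub (a - b * c ^+ 2) b cq
  (continuous_sub (continuous_scale (c := 1) cqcc) (continuous_scale (c := 2 * c) cqc))
  IH (cos_orthogonal_sub 1 (2 * c) cqcc cqc o2 o1).
move=> o k; rewrite -[RHS](o k); apply: eq_segint => t _.
by rewrite /q exprS; ring.
Qed.

Lemma bernoulli_le (x : R) n : 0 <= x -> 1 + n%:R * x <= (1 + x) ^+ n.
Proof.
move=> x0; elim: n => [|n IH]; first by rewrite mul0r addr0 expr0.
have nx : 0 <= n%:R * x ^+ 2 by rewrite mulr_ge0 // sqr_ge0.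
rewrite exprS -natr1; apply: le_trans (ler_wpM2l _ IH); nra.
Qed.

Lemma segint_bound h (a b : R) : a <= b -> continuous h ->
  exists M, forall t, a <= t <= b -> `|h t| <= M.
Proof.
move=> ab ch; have cn : {within `[a, b], continuous (fun t => `|h t|)}.
  by apply: continuous_subspaceT => t; apply: cvg_norm; exact: ch.
by have [c _ hc] := EVT_max ab cn; exists `|h c| => t tab; apply: hc; rewrite in_itv.
Qed.

(* The kernel p is nonnegative and exceeds 1 at u, but only where h >= c.  By
   Bernoulli's inequality the integral of h * p^n would grow linearly in n if
   h u > 0, whereas it vanishes by orthogonality. *)
Lemma cos_orthogonal_le0 h u : continuous h -> cos_orthogonal h ->
  0 < u < pi -> h u <= 0.
Proof.
move=> ch oh /andP[u0 upi]; rewrite leNgt; apply/negP => hu.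
pose c := h u / 2; have c0 : 0 < c by rewrite divr_gt0.
have [d [d0 du dpi dh]] : exists d, [/\ 0 < d, d < u, d < pi - u &
    forall t, `|t - u| < d -> c <= h t].
  have hc : c < h u by rewrite /c ltr_pdivrMr // ltr_pMr // ltr1n.
  have : nbhs u (fun t => c < h t) by exact: (@cvgr_gt _ _ _ _ _ _ (ch u) _ hc).
  move=> /nbhs_ballP[d /= d0 dh].
  exists (Num.min d (Num.min (u / 2) ((pi - u) / 2))); split.
  - by rewrite !lt_min d0 !divr_gt0 // subr_gt0.
  - rewrite gt_min gt_min (_ : u / 2 < u) ?orbT //; lra.
  - rewrite gt_min gt_min (_ : (pi - u) / 2 < pi - u) ?orbT //; lra.
  - move=> t; rewrite lt_min => /andP[td _]; apply/ltW/dh.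
    by rewrite /ball /= distrC.
(* Closeness to u must be read off from cos t, the only variable available to the kernel. With w the
   smaller change of cos between u and u - d or u + d, monotonicity on [0, pi] shows that |cos t -
   cos u| < w forces |t - u| < d; take 4 e = w^2. *)
have [e [e0 e1 dh2]] : exists e, [/\ 0 < e, e <= 1 & forall t, 0 <= t <= pi ->
    (cos t - cos u) ^+ 2 < 4 * e -> c <= h t].
  have u_in : u \in `[0, pi] by rewrite in_itv /= !ltW.
  have ud_in : u + d \in `[0, pi] by rewrite in_itv /=; apply/andP; split; lra.
  have du_in : u - d \in `[0, pi] by rewrite in_itv /=; apply/andP; split; lra.
  have c1 : cos (u + d) < cos u by rewrite ltr_cos //; lra.
  have c2 : cos u < cos (u - d) by rewrite ltr_cos //; lra.
  have lec x y : x \in `[0, pi] -> y \in `[0, pi] -> x <= y -> cos y <= cos x :> R.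
    by move=> xI yI; rewrite le_eqVlt => /predU1P[->|xy] //; rewrite ltW // ltr_cos.
  pose w := Num.min (cos u - cos (u + d)) (cos (u - d) - cos u).
  have w0 : 0 < w by rewrite lt_min !subr_gt0 c1.
  have w1 : w <= cos u - cos (u + d) by rewrite ge_min lexx.
  have w2 : w <= cos (u - d) - cos u by rewrite ge_min lexx orbT.
  have wle2 : w <= 2 by have := cos_le1 u; have := cos_geN1 (u + d); lra.
  exists (w ^+ 2 / 4); split.
  - by rewrite divr_gt0 // exprn_gt0.
  - nra.
  move=> t tpi; rewrite mulrC divfK ?pnatr_eq0 // => tw.
  have tI : t \in `[0, pi] by rewrite in_itv.
  apply: dh; rewrite ltr_norml; apply/andP; split; rewrite ltNge; apply/negP => td.
    have : cos (u - d) <= cos t by apply: lec => //; lra.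
    nra.
  have : cos t <= cos (u + d) by apply: lec => //; lra.
  nra.
have [M hM] := segint_bound (pi_ge0 R) ch.
(* The factor 1/4 keeps p nonnegative, as two cosines differ by at most 2, and p > 1 holds exactly
   when (cos t - cos u)^2 < 4 e. The function q is the positive part of p - 1, with q u = e. *)
pose p t := 1 + e - 4^-1 * (cos t - cos u) ^+ 2.
pose q t := Num.max (p t - 1) 0.
have cp : continuous p.
  apply: continuous_sub; first by move=> x; exact: cst_continuous.
  apply: continuous_scale; under eq_fun do rewrite expr2.
  by apply: continuous_mul; apply: continuous_sub => x; [exact: continuous_cos|
    exact: cst_continuous|exact: continuous_cos|exact: cst_continuous].
have cq : continuous q.
  have cp1 : continuous (fun t => p t - 1).
    by apply: continuous_sub => // y; exact: cst_continuous.
  by move=> x; apply: (continuous_max (cp1 x)); exact: (@cst_continuous _ _ 0).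
have p_ge0 t : 0 <= p t.
  have := cos_le1 t; have := cos_geN1 t; have := cos_le1 u; have := cos_geN1 u.
  rewrite /p; nra.
have q_ge0 t : 0 <= q t by rewrite le_max lexx orbT.
(* Where p <= 1 the term is at least -M; where p > 1, h is at least c and Bernoulli gives p^n >= 1 +
   n q. *)
have bound n t : 0 <= t <= pi -> (c * n%:R) * q t - M <= h t * p t ^+ n.
  move=> tpi; have pn0 : 0 <= p t ^+ n by rewrite exprn_ge0.
  have M0 : 0 <= M by apply: le_trans (hM _ tpi).
  have [p1|p1] := leP (p t) 1.
    have -> : q t = 0 by apply/max_r; rewrite subr_le0.
    rewrite mulr0 sub0r; apply: (@le_trans _ _ (- (M * p t ^+ n))).
      by rewrite lerN2 ler_piMr // exprn_ile1.
    by rewrite -mulNr ler_wpM2r //; have := hM _ tpi; rewrite ler_norml => /andP[].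
  have qE : q t = p t - 1 by apply/max_l; rewrite subr_ge0 ltW.
  have ct : c <= h t by apply: dh2 => //; move: p1; rewrite /p; lra.
  apply: (@le_trans _ _ (c * p t ^+ n)); last exact: ler_wpM2r.
  have := @bernoulli_le (q t) n (q_ge0 t); rewrite {2}qE subrKC => bt.
  apply: (@le_trans _ _ (c * (1 + n%:R * q t))); last by rewrite ler_wpM2l // ltW.
  by rewrite mulrDr mulrA mulr1 addrC lerD2r; lra.
have cst (y : R) : continuous (fun _ : R => y) by move=> x; exact: cst_continuous.
have int_le n : c * n%:R * segint 0 pi q <= M * pi.
  have -> : M * pi = segint 0 pi (fun=> M).
    by rewrite segint_cst ?pi_ge0 // subr0.
  rewrite -subr_le0 -segintZ // -segintB //; last exact: continuous_scale.
  have z : segint 0 pi (fun t => h t * p t ^+ n) = 0.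
    rewrite -[RHS](cos_orthogonal_pow (1 + e) 4^-1 (cos u) n ch oh 0%N).
    by apply: eq_segint => t _; rewrite mul0r cos0 mulr1.
  rewrite -[leRHS]z; apply: le_segint.
  - by apply: continuous_sub => //; exact: continuous_scale.
  - apply: continuous_mul => //; elim: n {z} => [|n IH]; first exact: cst.
    by under eq_fun do rewrite exprS; exact: continuous_mul.
  - exact: bound.
have q_eq0 : q u = 0.
  apply: (@segint_ge0_eq0 R 0 pi q) => //; last by rewrite u0.
  rewrite leNgt; apply/negP => Q0.
  have := int_le (Num.truncn (M * pi / (c * segint 0 pi q))).+1.
  rewrite leNgt => /negP; apply; rewrite mulrAC -ltr_pdivrMl ?mulr_gt0 //.
  by rewrite mulrC truncnS_gt.
have : q u = e by rewrite /q /p subrr expr0n mulr0 subr0 addrC addKr; apply/max_l/ltW.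
by rewrite q_eq0 => ee; rewrite -ee ltxx in e0.
Qed.

Lemma cos_orthogonal_eq0 h u : continuous h -> cos_orthogonal h ->
  0 < u < pi -> h u = 0.
Proof.
move=> ch oh upi; apply/eqP; rewrite eq_le cos_orthogonal_le0 //=.
have cn : continuous (fun t => - 1 * h t) by apply: continuous_scale.
rewrite -oppr_le0 -mulN1r; apply: (cos_orthogonal_le0 cn) => // k.
transitivity (-1 * segint 0 pi (fun t => h t * cos (k%:R * t)));
  last by rewrite oh mulr0.
rewrite -segintZ; last by apply: continuous_mul => //; exact: continuous_cosM.
by apply: eq_segint => t _; rewrite mulrA.
Qed.
End CosineUniqueness.

(** * Absolutely convergent cosine series *)

Section CosineSeries.
Variable R : realType.
Implicit Types (g : R -> R) (a : nat -> R) (t B : R).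

(** Weierstrass M-test, with r N the tail of the series of absolute values. That r tends to 0 gives
    continuity of S and termwise integration; its comparison with B gives the numerical error
    bound. *)
Lemma abs_summable_cos_series a B : (forall N, \sum_(0 <= k < N) `|a k| <= B) ->
  exists (S : R -> R) (r : nat -> R),
  [/\ continuous S, forall e, 0 < e -> exists N0, forall N, (N0 <= N)%N -> r N <= e,
      forall N, r N <= B - \sum_(0 <= k < N) `|a k|
    & forall t N, `|S t - \sum_(0 <= k < N) a k * cos (k%:R * t)| <= r N].
Proof.
move=> aB; pose u := series (fun k => `|a k|);
  pose v t := series (fun k => a k * cos (k%:R * t)).
have u_nd : nondecreasing_seq u by apply: nondecreasing_series.
have cu : cvgn u.
  by apply: nondecreasing_is_cvgn => //; exists B => _ [N _ <-]; exact: aB.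
have uL N : u N <= limn u by exact: nondecreasing_cvgn_le.
have LB : limn u <= B by apply: limr_le => //; near=> N; exact: aB.
have vu t N M : (N <= M)%N -> `|v t M - v t N| <= u M - u N.
  move=> NM; rewrite /v /u !sub_series_geq //.
  apply: le_trans (ler_norm_sum _ _ _) _; apply: ler_sum => k _.
  by rewrite normrM ler_piMr // cos_max.
have cv t : cvgn (v t).
  apply: normed_cvg; apply: series_le_cvg cu => [k|k|k] /=; rewrite ?normr_ge0 //.
  by rewrite normrM ler_piMr // cos_max.
pose S t := limn (v t).
have Sv t N : `|S t - v t N| <= limn u - u N.
  apply/ler_addgt0Pr => e e0.
  near \oo => M.
  have NM : (N <= M)%N by near: M; exists N.
  have H : `|S t - v t M| <= e by near: M; exact: (cvgr_dist_le _ _ (cv t)).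
  have -> : S t - v t N = (v t M - v t N) + (S t - v t M) by ring.
  apply: le_trans (ler_normD _ _) _; apply: lerD => //.
  by apply: le_trans (vu _ _ _ NM) _; rewrite lerD2r.
have r0 e : 0 < e -> exists N0, forall N, (N0 <= N)%N -> limn u - u N <= e.
  move=> e0; have [N0 _ HN] := cvgr_dist_le _ _ cu _ e0; exists N0 => N /HN.
  by apply: le_trans; exact: ler_norm.
exists S, (fun N => limn u - u N); split => //.
- move=> x; apply/cvgrPdist_le => e e0.
  have [N /(_ _ (leqnn N)) HN] := r0 (e / 3) (divr_gt0 e0 (ltr0n _ 3)).
  have cvN : continuous (fun t => v t N).
    rewrite /v /series /=; under eq_fun do rewrite big_mkord.
    by apply: continuous_sum => k; apply: continuous_scale; exact: continuous_cosM.
  have e3 : 0 < e / 3 by rewrite divr_gt0.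
  near=> y; have vxy : `|v x N - v y N| <= e / 3 by near: y;
    exact: (cvgr_dist_le _ _ (cvN x)).
  have -> : S x - S y = (S x - v x N) + (v x N - v y N) - (S y - v y N) by ring.
  apply: le_trans (ler_normB _ _) _; have := ler_normD (S x - v x N) (v x N - v y N).
  have := Sv x N; have := Sv y N; lra.
- by move=> N; rewrite lerD2r.
Unshelve. all: by end_near. Qed.

Lemma segint_cos_cos (k m : nat) :
  segint 0 pi (fun t : R => cos (k%:R * t) * cos (m%:R * t)) =
  if k == m then pi / (if m == 0%N then 1 else 2) else 0.
Proof.
rewrite (eq_segint (g := fun t => 2^-1 * (cos ((k%:R - m%:R) * t) +
    cos (((k + m)%:R - 0%:R) * t)))); last first.
  by move=> t _; rewrite cosM_cosM subr0 natrD.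
rewrite segintZ; last by apply: continuous_add; exact: continuous_cosM.
rewrite segintD; try exact: continuous_cosM.
rewrite !segint_cosM addn_eq0; have [->|km] := eqVneq k m.
  by case: (m == 0)%N => /=; field.
case: (eqVneq k 0%N) km => [->|_ _]; last by rewrite addr0 mulr0.
by rewrite eq_sym => /negPf ->; rewrite addr0 mulr0.
Qed.

(** The uniqueness theorem speaks of interior points only; the ends t = 0 and t = pi, that is x = 1
    and x = -1, are recovered by continuity. *)
Lemma eq_oo_eq_cc (h : R -> R) (a b : R) : a < b -> continuous h ->
  (forall t, a < t < b -> h t = 0) -> forall t, a <= t <= b -> h t = 0.
Proof.
move=> ab ch h0 t /andP[]; rewrite le_eqVlt => /predU1P[<- _|at_].
  have H1 : h x @[x --> a^'+] --> h a by apply: cvg_at_right_filter; exact: ch.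
  rewrite -(cvg_lim _ H1) //; apply: lim_near_cst => //; near=> x; apply: h0.
  by apply/andP; split.
rewrite le_eqVlt => /predU1P[->|tb]; last by apply: h0; rewrite at_.
have H1 : h x @[x --> b^'-] --> h b by apply: cvg_at_left_filter; exact: ch.
rewrite -(cvg_lim _ H1) //; apply: lim_near_cst => //; near=> x; apply: h0.
by apply/andP; split.
Unshelve. all: by end_near. Qed.

(** For g = f o cos these are the Chebyshev coefficients of f. The case distinction inverts the
    integral of cos(kt)^2, which is pi for k = 0 and pi/2 otherwise. *)
Definition cos_coef g (k : nat) : R :=
  (if k == 0%N then 1 else 2) / pi * segint 0 pi (fun t => g t * cos (k%:R * t)).

(** The sum S of the series has the same cosine moments as g, hence equals g, and the error after j
    terms is the tail of the absolute coefficients. The first j of them enter the total bound [aB]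
    and cancel at the end. *)
Lemma cos_series_tail g (j : nat) B : continuous g ->
  (forall N, \sum_(j <= k < N) `|cos_coef g k| <= B) ->
  forall t, 0 <= t <= pi ->
  `|g t - \sum_(k < j) cos_coef g k * cos (k%:R * t)| <= B.
Proof.
move=> cg gB; set a := cos_coef g in gB *.
have aB N : \sum_(0 <= k < N) `|a k| <= \sum_(0 <= k < j) `|a k| + B.
  have [jN|Nj] := leqP j N; first by rewrite (big_cat_nat (leq0n j) jN) //= lerD2l.
  rewrite (big_cat_nat (leq0n N) (ltnW Nj)) //= -addrA lerDl addr_ge0 //.
    by apply: sumr_ge0 => k _.
  by have := gB j; rewrite big_geq.
have [S [r [cS r0 rB Sr]]] := abs_summable_cos_series aB.
have orth : cos_orthogonal (fun t => g t - S t).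
  move=> m; apply/eqP; rewrite -normr_le0; apply/ler_addgt0Pr => e e0.
  have [N0 HN] := r0 (e / pi) (divr_gt0 e0 (pi_gt0 R)).
  (* N must exceed m for the partial sum s to contain the m-th term. Then s and g have the same m-th
     moment, and g may be exchanged for s, which is uniformly within e / pi of S. *)
  pose N := maxn N0 m.+1.
  pose s t := \sum_(k < N) a k * cos (k%:R * t).
  have cs : continuous s.
    by apply: continuous_sum => k; apply: continuous_scale; exact: continuous_cosM.
  have ccm := @continuous_cosM R m%:R.
  have Is : segint 0 pi (fun t => s t * cos (m%:R * t))
    = segint 0 pi (fun t => g t * cos (m%:R * t)).
    rewrite (eq_segint (g := fun t => \sum_(k < N) a k
      * (cos (k%:R * t) * cos (m%:R * t)))).
      have ckm (k : 'I_N) : continuous (fun t : R => cos (k%:R * t) * cos (m%:R * t)).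
        by apply: continuous_mul; exact: continuous_cosM.
      rewrite segint_sum; last by move=> k; apply: continuous_scale; exact: ckm.
      have mN : (m < N)%N by exact: leq_maxr.
      rewrite (bigD1 (Ordinal mN)) //= big1 ?addr0; last first.
        move=> k; rewrite -val_eqE /= => km.
        by rewrite segintZ ?segint_cos_cos ?(negPf km) ?mulr0 //; exact: ckm.
      rewrite segintZ; last exact: (ckm (Ordinal mN)).
      rewrite segint_cos_cos eqxx /a /cos_coef.
      move: (segint 0 pi _) (pi_gt0 R) => I; move: pi => p p0.
      by case: (m == 0)%N; field; rewrite gt_eqF.
    by move=> t _; rewrite mulr_suml; apply: eq_bigr => k _; rewrite mulrA.
  have -> : segint 0 pi (fun t => (g t - S t) * cos (m%:R * t))
    = segint 0 pi (fun t => (s t - S t) * cos (m%:R * t)).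
    have E (f : R -> R) : continuous f ->
      segint 0 pi (fun t => (f t - S t) * cos (m%:R * t))
      = segint 0 pi (fun t => f t * cos (m%:R * t))
        - segint 0 pi (fun t => S t * cos (m%:R * t)).
      move=> cf; rewrite -segintB; try exact: continuous_mul.
      by apply: eq_segint => t _; rewrite mulrBl.
    by rewrite !E // Is.
  have -> : 0 + e = e / pi * (pi - 0) by rewrite subr0 add0r divfK // gt_eqF // pi_gt0.
  apply: segint_norm_le; first exact: pi_ge0.
    by apply: continuous_mul => //; exact: continuous_sub.
  move=> t _; rewrite normrM; apply: le_trans (ler_piMr _ (cos_max _)) _ => //.
  rewrite distrC /s -(big_mkord xpredT (fun k => a k * cos (k%:R * t))).
  by apply: le_trans (Sr _ _) (HN _ _); exact: leq_maxl.
have gS t : 0 <= t <= pi -> g t = S t.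
  move=> tpi; apply/eqP; rewrite -subr_eq0; apply/eqP.
  have cgS : continuous (fun t => g t - S t) by exact: continuous_sub.
  apply: (eq_oo_eq_cc (pi_gt0 R) cgS) tpi => u.
  exact: cos_orthogonal_eq0 cgS orth.
move=> t tpi; rewrite gS // -(big_mkord xpredT (fun k => a k * cos (k%:R * t))).
apply: le_trans (Sr _ _) _; apply: le_trans (rB _) _.
by rewrite addrAC subrr add0r.
Qed.

End CosineSeries.

(** * Functions with a derivative of bounded variation *)

Section BoundedVariation.
Variable R : realType.
Implicit Types (f g : R -> R) (V : R) (t : R).

Lemma cos_itv t : cos t \in `[-1, 1].
Proof. by rewrite in_itv /= cos_geN1 cos_le1. Qed.

Lemma absolutely_continuous_uniform f e : absolutely_continuous_on `[-1, 1] f ->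
  0 < e -> exists2 d, 0 < d &
  forall x y, x \in `[-1, 1] -> y \in `[-1, 1] -> `|x - y| < d -> `|f x - f y| < e.
Proof.
move=> acf e0; have [d d0 fd] := acf _ e0; exists d => // x y xI yI.
wlog yx : x y xI yI / y <= x.
  by move=> H; case: (leP y x) => [|/ltW] /H;
    rewrite ?xI ?yI // ![`|x - _|]distrC [`|f x - _|]distrC; exact.
rewrite ger0_norm ?subr_ge0 // => xyd.
have := fd 1%N (fun=> y) (fun=> x); rewrite !big_ord1; apply => //.
by move=> i j _ _ _; rewrite !ord1.
Qed.

Lemma continuous_comp_cos f : absolutely_continuous_on `[-1, 1] f ->
  continuous (fun t => f (cos t)).
Proof.
move=> acf t; apply/cvgrPdist_lt => e e0.
have [d d0 fd] := absolutely_continuous_uniform acf e0.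
near=> u; apply: fd; rewrite ?cos_itv //.
by apply: le_lt_trans (cos_lipschitz _ _) _; near: u; apply: cvgr_dist_lt.
Unshelve. all: by end_near. Qed.

Lemma is_derive_quotient g t l :
  (fun h => h^-1 * (g (h + t) - g t)) @ 0^' --> l -> is_derive t 1 g l.
Proof.
move=> gl; have E : (fun h => h^-1 *: ((g \o shift t) (h *: 1) - g t))
    = (fun h => h^-1 * (g (h + t) - g t)).
  by apply/funext => h /=; rewrite [h *: 1]mulr1.
have gl' : (fun h => h^-1 *: ((g \o shift t) (h *: 1) - g t)) @ 0^' --> l by rewrite E.
by split; [apply/cvg_ex; exists l|exact: cvg_lim gl'].
Qed.

(** Caratheodory's form of the chain rule: the slope q is completed by f'(cos t) at cos t, so the
    factorization of the increment holds even where cos(h + t) = cos t. Only values of f on [-1, 1]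
    occur, so the one-sided derivatives at the ends suffice. *)
Lemma is_derive_comp_cos f f' t : derivative_on `[-1, 1] f f' ->
  is_derive t 1 (fun u => f (cos u)) (- f' (cos t) * sin t).
Proof.
move=> df; pose q y := if y == cos t then f' (cos t) else
  (f y - f (cos t)) / (y - cos t).
have fq y : f y - f (cos t) = q y * (y - cos t).
  rewrite /q; case: eqVneq => [->|yt]; first by rewrite !subrr mulr0.
  by rewrite divfK // subr_eq0.
have cq : (fun u => q (cos u)) @ t --> f' (cos t).
  apply/cvgrPdist_lt => e e0.
  have /cvgrPdist_lt/(_ e e0) := df (cos t) (cos_itv t).
  rewrite near_withinE => /nbhs_ballP[d /= d0 dq].
  have : nbhs t (fun u => `|cos t - cos u| < d).
    exact: (@cvgr_dist_lt _ _ _ _ _ _ _ (@continuous_cos R t)).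
  apply: filterS => u ud; rewrite /q; case: eqVneq => [_|ut].
    by rewrite subrr normr0.
  by apply: dq => //; [exact: cos_itv].
apply: is_derive_quotient.
have -> : (fun h => h^-1 * (f (cos (h + t)) - f (cos t)))
    = (fun h => q (cos (h + t)) * (h^-1 * (cos (h + t) - cos t))).
  by apply/funext => h; rewrite fq mulrCA.
have -> : - f' (cos t) * sin t = f' (cos t) * - sin t by ring.
apply: cvgM.
  apply: cvg_within_filter;
    apply: (cvg_comp (fun h => h + t) (fun u => q (cos u)) _ cq).
  have ct : continuous (fun h => h + t).
    by apply: continuous_add => x; [exact: cvg_id|exact: cst_continuous].
  by have := ct 0; rewrite /continuous_at add0r.
have [dc dcE] := is_derive_cos t.
have H : (fun h => h^-1 *: ((cos \o shift t) (h *: 1) - cos t)) @ 0^' --> 'D_1 cos t :=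
  dc.
rewrite dcE in H.
have -> // : (fun h => h^-1 * (cos (h + t) - cos t)) =
   (fun h => h^-1 *: ((cos \o shift t) (h *: 1) - cos t)).
by apply/funext => h /=; rewrite [h *: 1]mulr1.
Qed.

(** Since cos decreases, the partition runs down from 1. Its intervals are split off one at a time
    from the right, the variation over [-1, c k] being what remains. *)
Lemma variation_cos_le f V (c : nat -> R) n :
  (total_variation (-1) 1 f <= V%:E)%E ->
  c 0%N = 1 -> (forall i, (i < n)%N -> c i.+1 <= c i) -> (forall i, -1 <= c i) ->
  \sum_(i < n) `|f (c i.+1) - f (c i)| <= V.
Proof.
move=> fV c0 cn c1; rewrite -lee_fin; apply: le_trans fV.
suff H k : (k <= n)%N -> ((\sum_(i < k) `|f (c i.+1) - f (c i)|)%:E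
  + total_variation (-1) (c k) f
    <= total_variation (-1) 1 f)%E.
  apply: le_trans (H n (leqnn n)); rewrite leeDl //; exact: total_variation_ge0.
elim: k => [|k IH] kn; first by rewrite big_ord0 add0e c0.
apply: le_trans (IH (ltnW kn)); rewrite big_ord_recr /= EFinD -addeA leeD2l //.
rewrite [leRHS](@total_variationD _ (-1) (c k) (c k.+1)) ?c1 ?cn //.
rewrite addeC leeD2l // distrC; apply: total_variation_ge; exact: cn.
Qed.

(** Mean value theorem for G - g(a) H, whose derivative is (g - g(a)) h. On a short interval g is
    thus frozen at its left end while h is integrated exactly. *)
Lemma riemann_step (g G H h : R -> R) (a b e : R) : a <= b ->
  (forall t, a <= t <= b -> is_derive t 1 G (g t * h t)) ->
  (forall t, is_derive t 1 H (h t)) -> (forall t, `|h t| <= 1) ->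
  (forall t, a <= t <= b -> `|g t - g a| <= e) ->
  `|(G b - G a) - g a * (H b - H a)| <= e * (b - a).
Proof.
move=> ab dG dH h1 ge; pose D t := G t - g a * H t.
have dD t : t \in `[a, b] -> is_derive t 1 D ((g t - g a) * h t).
  rewrite in_itv /= => /dG dGt; rewrite mulrBl.
  exact: is_derive_sub dGt (is_derive_scale (g a) (dH t)).
have dD' t : t \in `]a, b[ -> is_derive t 1 D ((g t - g a) * h t).
  by move=> tI; apply: dD; exact: subset_itv_oo_cc tI.
have cD : {within `[a, b], continuous D}.
  by apply: derivable_within_continuous => t /dD[].
have [c cI DE] := MVT_segment ab dD' cD.
have -> : (G b - G a) - g a * (H b - H a) = D b - D a by rewrite /D; ring.
rewrite DE normrM [X in _ * X]ger0_norm ?subr_ge0 // ler_wpM2r ?subr_ge0 //.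
rewrite normrM; apply: le_trans (ler_piMr _ (h1 _)) _ => //.
by apply: ge; rewrite in_itv in cI.
Qed.

(* Abel summation over the uniform partition of [0, pi] into n pieces, with n
   so large that f (cos t) varies by at most e / pi on each of them. *)
Lemma segint_bv_cos_le f V (k : nat) : (0 < k)%N ->
  absolutely_continuous_on `[-1, 1] f ->
  (total_variation (-1) 1 f <= V%:E)%E ->
  `|segint 0 pi (fun t => f (cos t) * cos (k%:R * t))| <= V / k%:R.
Proof.
move=> k0 acf fV; apply/ler_addgt0Pr => e e0.
have kR : 0 < k%:R :> R by rewrite ltr0n.
have cf := continuous_comp_cos acf.
have cfk : continuous (fun t => f (cos t) * cos (k%:R * t)).
  by apply: continuous_mul => //; exact: continuous_cosM.
pose H t := k%:R^-1 * sin (k%:R * t).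
have dH t : is_derive t 1 H (cos (k%:R * t)).
  have -> : cos (k%:R * t) = k%:R^-1 * (cos (k%:R * t) * k%:R).
    by rewrite mulrCA mulVf ?mulr1 // gt_eqF.
  exact/is_derive_scale/is_derive_sinM.
have H_le t : `|H t| <= k%:R^-1.
  rewrite normrM gtr0_norm ?invr_gt0 //; apply: ler_piMr; last exact: sin_max.
  by rewrite invr_ge0 ltW.
have [G dG] := antiderivative_exists (pi + 1) cfk.
have dG' t : 0 <= t <= pi -> is_derive t 1 G (f (cos t) * cos (k%:R * t)).
  by move=> /andP[t0 tpi]; apply: dG; rewrite ger0_norm //; lra.
rewrite (segint_FTC (pi_gt0 R) cfk dG').
have pi0 : 0 < pi :> R by exact: pi_gt0.
have epi : 0 < e / pi by rewrite divr_gt0 // pi_gt0.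
have [d d0 fd] := absolutely_continuous_uniform acf epi.
pose n := (Num.truncn (pi / d)).+1.
pose s i : R := i%:R * (pi / n%:R).
have n0 : 0 < n%:R :> R by rewrite ltr0n.
have h0 : 0 < pi / n%:R :> R by rewrite divr_gt0 // pi_gt0.
have hd : pi / n%:R < d.
  by rewrite ltr_pdivrMr // -ltr_pdivrMl // mulrC truncnS_gt.
have s0 : s 0%N = 0 by rewrite /s mul0r.
have sn : s n = pi by rewrite /s mulrC divfK // gt_eqF.
have sS i : s i.+1 = s i + pi / n%:R by rewrite /s -natr1 mulrDl mul1r.
clearbody n.
have s_itv i : (i <= n)%N -> 0 <= s i <= pi.
  move=> i_n; apply/andP; split; first by rewrite /s mulr_ge0 // ltW.
  by rewrite -[leRHS]sn /s ler_wpM2r ?ler_nat // ltW.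
have step i : (i < n)%N ->
  `|(G (s i.+1) - G (s i)) - f (cos (s i)) * (H (s i.+1) - H (s i))| <= e / pi
    * (pi / n%:R).
  move=> i_n; have si := s_itv _ (ltnW i_n); have si1 := s_itv _ i_n.
  have -> : pi / n%:R = s i.+1 - s i by rewrite sS addrC addKr.
  have le_s : s i <= s i.+1 by rewrite sS lerDl ltW.
  apply: (riemann_step (g := fun t => f (cos t)) (h := fun t => cos (k%:R * t))) => //.
  - by move=> t /andP[t1 t2]; apply: dG'; lra.
  - by move=> t; exact: cos_max.
  move=> t /andP[t1 t2]; apply/ltW/fd; rewrite ?cos_itv //.
  apply: le_lt_trans (cos_lipschitz _ _) _; rewrite ger0_norm ?subr_ge0 //.
  by rewrite sS in t2; lra.
have GE : G pi - G 0 = \sum_(i < n) (G (s i.+1) - G (s i)).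
  by rewrite -sn -[in LHS]s0 -(telescope_sumr (fun i => G (s i))) // big_mkord.
(* The boundary terms vanish because H t = sin(kt) / k is zero at 0 and at pi. The differences now
   fall on f o cos, where the variation controls them, and |H| <= 1/k gives the denominator. *)
have abel : \sum_(i < n) f (cos (s i)) * (H (s i.+1) - H (s i))
    = - \sum_(i < n) H (s i.+1) * (f (cos (s i.+1)) - f (cos (s i))).
  apply/eqP; rewrite -addr_eq0 -big_split /=; apply/eqP.
  transitivity (\sum_(0 <= i < n) (f (cos (s i.+1)) * H (s i.+1) - f (cos (s i))
    * H (s i))).
    by rewrite big_mkord; apply: eq_bigr => i _; ring.
  rewrite (telescope_sumr (fun i => f (cos (s i)) * H (s i))) // s0 sn /H.
  by rewrite (mulr0 k%:R) sin0 sin_natpi !mulr0 subrr.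
have -> : G pi - G 0 = \sum_(i < n) ((G (s i.+1) - G (s i)) - f (cos (s i))
  * (H (s i.+1) - H (s i)))
   - \sum_(i < n) H (s i.+1) * (f (cos (s i.+1)) - f (cos (s i))).
  by rewrite sumrB abel GE opprK addrK.
rewrite addrC; apply: le_trans (ler_normD _ _) _; apply: lerD.
  rewrite normrN; apply: le_trans (ler_norm_sum _ _ _) _.
  apply: (@le_trans _ _ (k%:R^-1 * \sum_(i < n) `|f (cos (s i.+1)) - f (cos (s i))|)).
    by rewrite mulr_sumr; apply: ler_sum => i _; rewrite normrM ler_wpM2r.
  rewrite mulrC ler_wpM2r ?invr_ge0 ?(ltW kR) //.
  apply: (@variation_cos_le f V (fun i => cos (s i))) => //.
  - by rewrite s0 cos0.
  - move=> i i_n; have := s_itv _ (ltnW i_n); have := s_itv _ i_n => si1 si.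
    by rewrite leNgt ltr_cos ?in_itv // -leNgt sS lerDl ltW.
  - by move=> i; exact: cos_geN1.
apply: le_trans (ler_norm_sum _ _ _) _.
apply: (@le_trans _ _ (\sum_(i < n) e / pi * (pi / n%:R))).
  by apply: ler_sum => i _; exact: step.
rewrite sumr_const card_ord -[leLHS]mulr_natr -mulrA [pi / _ * _]divfK ?gt_eqF // divfK
  ?gt_eqF //.
Qed.

(** Left unnormalized, unlike [cos_coef], so that the recurrence below has the same form when the
    index 0 occurs in it. *)
Definition cos_moment f (k : nat) : R :=
  segint 0 pi (fun t => f (cos t) * cos (k%:R * t)).

(** Integration by parts against sin(ct) / c, which vanishes at both ends; the factor sin t from the
    chain rule turns sin(ct) into a difference of two cosines. *)
Lemma cos_moment_derivative f f' (k : nat) :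
  absolutely_continuous_on `[-1, 1] f -> absolutely_continuous_on `[-1, 1] f' ->
  derivative_on `[-1, 1] f f' ->
  cos_moment f k.+1 = (cos_moment f' k - cos_moment f' k.+2) / (2 * k.+1%:R).
Proof.
move=> acf acf' df; pose c : R := k.+1%:R; have c0 : c != 0 by rewrite pnatr_eq0.
have cf := continuous_comp_cos acf; have cf' := continuous_comp_cos acf'.
have ck l : continuous (fun t => f' (cos t) * cos (l * t)).
  by apply: continuous_mul => //; exact: continuous_cosM.
have ckf : continuous (fun t => f (cos t) * cos (c * t)).
  by apply: continuous_mul => //; exact: continuous_cosM.
pose r t := (2 * c)^-1 * (f' (cos t) * cos (k%:R * t) - f' (cos t) * cos (k.+2%:R * t)).
have cr : continuous r by apply: continuous_scale; exact: continuous_sub.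
have dP t : is_derive t 1 (fun u => c^-1 * (f (cos u) * sin (c * u)))
    (f (cos t) * cos (c * t) - r t).
  have -> : f (cos t) * cos (c * t) - r t = c^-1 * (f (cos t) * (cos (c * t) * c)
      + sin (c * t) * (- f' (cos t) * sin t)).
    have E : cos (k%:R * t) - cos (k.+2%:R * t) = 2 * sin (c * t) * sin t.
      have -> : k%:R = c - 1 by rewrite /c -natr1 addrK.
      have -> : k.+2%:R = c + 1 by rewrite /c natr1.
      by rewrite mulrBl mulrDl mul1r cosB cosD; ring.
    by rewrite /r -mulrBr E; field.
  exact: is_derive_scale (is_derive_mul (is_derive_comp_cos t df) (is_derive_sinM c t)).
have := segint_FTC (pi_gt0 R) (continuous_sub ckf cr) (fun t _ => dP t).
rewrite (mulr0 c) sin0 sin_natpi !mulr0 subrr segintB // => /eqP.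
rewrite subr_eq0 => /eqP E.
rewrite [LHS]/cos_moment -/c E segintZ; last exact: continuous_sub.
by rewrite segintB // mulrC.
Qed.

Lemma leq_ffact (m n k : nat) : (m <= n)%N -> (m ^_ k <= n ^_ k)%N.
Proof.
elim: k m n => [|k IH] m n mn; first by rewrite !ffactn0.
by rewrite !ffactnS leq_mul // IH // -!subn1 leq_sub2r.
Qed.

Lemma expn_le_ffact (n m : nat) : ((n - m) ^ m <= n ^_ m)%N.
Proof.
elim: m => [|m IH]; first by rewrite ffactn0.
have le1 : (n - m.+1 <= n - m)%N by rewrite leq_sub2l.
rewrite ffactnSr expnSr leq_mul //; apply: leq_trans IH.
by case: m le1 => // m le1; rewrite leq_exp2r.
Qed.

(** Induction on nu along the sequence of derivatives. Of the two moments in the recurrence, the one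
    of lower index has the larger bound; using it for both absorbs the 2 in the denominator, and k
    (k-1)^_nu is the next falling factorial. *)
Lemma cos_moment_le f V nu k : (nu < k)%N -> 0 <= V -> bv_smooth nu V f ->
  `|cos_moment f k| <= V / (k ^_ nu.+1)%:R.
Proof.
move=> nuk V0 [g [g0 dg acg gV]].
have -> : cos_moment f k = cos_moment (g 0%N) k.
  by apply: eq_segint => t _; rewrite g0 // cos_itv.
elim: nu g k nuk dg acg gV {f g0} => [|nu IH] g k nuk dg acg gV.
  by rewrite ffactn1; apply: segint_bv_cos_le => //; exact: acg.
case: k nuk => // k nuk; rewrite ltnS in nuk.
rewrite (cos_moment_derivative _ (acg 0%N isT) (acg 1%N isT) (dg 0%N isT)).
have IH' l : (nu < l)%N -> `|cos_moment (g 1%N) l| <= V / (l ^_ nu.+1)%:R.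
  move=> nul; apply: (IH (fun i => g i.+1)) => // i i_nu; first exact: dg.
  exact: acg.
rewrite normrM [X in _ * X]gtr0_norm ?invr_gt0 ?mulr_gt0 // ffactSS natrM.
have f0 : 0 < (k ^_ nu.+1)%:R :> R by rewrite ltr0n ffact_gt0.
have -> : V / (k.+1%:R * (k ^_ nu.+1)%:R) =
   (V / (k ^_ nu.+1)%:R + V / (k ^_ nu.+1)%:R) / (2 * k.+1%:R).
  move: (k ^_ nu.+1)%:R f0 => q q0; have : k.+1%:R != 0 :> R by rewrite pnatr_eq0.
  by move: k.+1%:R => p p0; field; rewrite p0 gt_eqF.
rewrite ler_wpM2r ?invr_ge0 ?mulr_ge0 //.
apply: le_trans (ler_normB _ _) _; apply: lerD; first exact: IH'.
apply: le_trans (IH' _ (leq_trans nuk (leqW (leqW (leqnn k))))) _.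
rewrite ler_wpM2l // lef_pV2 ?posrE // ?ler_nat ?leq_ffact ?leqW //.
by rewrite ltr0n ffact_gt0 leqW // leqW.
Qed.

(** Telescoping: each summand equals w k - w (k+1) for w k = 1 / (nu (k-1)^_nu). *)
Lemma sum_inv_ffact_le (nu j N : nat) : (0 < nu)%N -> (nu < j)%N ->
  \sum_(j <= k < N) ((k ^_ nu.+1)%:R)^-1 <= (nu%:R * (j.-1 ^_ nu)%:R)^-1 :> R.
Proof.
move=> nu0 nuj; have nuR : 0 < nu%:R :> R by rewrite ltr0n.
have [Nj|/ltnW jN] := leqP N j; first by rewrite big_geq // invr_ge0 mulr_ge0.
pose w k : R := (nu%:R * (k.-1 ^_ nu)%:R)^-1.
have wE k : (j <= k)%N -> ((k ^_ nu.+1)%:R)^-1 = - w k.+1 - (- w k).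
  case: k => [|k] jk; first by rewrite leqn0 in jk; rewrite (eqP jk) in nuj.
  have nuk : (nu <= k)%N by rewrite -ltnS (leq_trans nuj).
  have f1 : (k ^_ nu)%:R != 0 :> R by rewrite pnatr_eq0 -lt0n ffact_gt0.
  have f2 : (k.+1 ^_ nu)%:R != 0 :> R by rewrite pnatr_eq0 -lt0n ffact_gt0 leqW.
  have E1 : (k.+1 ^_ nu.+1)%:R = k.+1%:R * (k ^_ nu)%:R :> R by rewrite ffactSS natrM.
  have E2 : (k.+1 ^_ nu.+1)%:R = (k.+1 ^_ nu)%:R * (k.+1%:R - nu%:R) :> R.
    by rewrite ffactnSr natrM natrB // leqW.
  rewrite opprK addrC /w /=; set a := (k ^_ nu)%:R in E1 f1 *;
    set b := (k.+1 ^_ nu)%:R in E2 f2 *.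
  set q := (k.+1 ^_ nu.+1)%:R in E1 E2 *.
  have q0 : q != 0 by rewrite E1 mulf_neq0 // pnatr_eq0.
  have : a * b * nu%:R = q * (b - a).
    by rewrite mulrBr {1}E1 E2; ring.
  move=> E; have nu1 : nu%:R != 0 :> R by rewrite gt_eqF.
  have -> : (nu%:R * a)^-1 - (nu%:R * b)^-1 = (q * (b - a)) / (q * (a * b * nu%:R)).
    by field; rewrite q0 f1 f2 nu1.
  by rewrite -E; field; rewrite q0 f1 f2 nu1.
rewrite (telescope_sumr_eq (fun k => - w k)) //; last by move=> k /andP[/wE].
by rewrite opprK addrC lerBlDr lerDl invr_ge0 mulr_ge0.
Qed.

Lemma bv_smooth_absolutely_continuous f V nu :
  bv_smooth nu V f -> absolutely_continuous_on `[-1, 1] f.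
Proof.
move=> [g [g0 _ acg _]] e /(acg 0%N isT e)[d d0 fd]; exists d => // n a b abI tab abd.
rewrite (eq_bigr (fun k => `|g 0%N (b k) - g 0%N (a k)|)); first exact: fd.
by move=> k _; have [_ aI bI] := abI k; rewrite !g0.
Qed.

(** The factor 2 / pi is the normalization of the coefficients, 1 / nu comes from the telescoping
    sum, and each factor of (j-1)^_nu is at least j - 1 - nu. *)
Lemma bv_smooth_cos_series f V nu (j : nat) : (0 < nu)%N -> (nu.+1 < j)%N -> 0 <= V ->
  bv_smooth nu V f -> forall t, 0 <= t <= pi ->
  `|f (cos t) - \sum_(k < j) cos_coef (fun t => f (cos t)) k * cos (k%:R * t)|
    <= 2 * V / (pi * nu%:R * (j%:R - 1 - nu%:R) ^+ nu).
Proof.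
move=> nu0 nuj V0 fV.
have nuR : 0 < nu%:R :> R by rewrite ltr0n.
have acf := bv_smooth_absolutely_continuous fV.
apply: cos_series_tail; first exact: continuous_comp_cos.
move=> N; have jE : j%:R - 1 - nu%:R = (j.-1 - nu)%:R :> R.
  case: j nuj => // j nuj; rewrite -natr1 addrK natrB // ltnW //.
have jnu : (0 < j.-1 - nu)%N by rewrite subn_gt0; case: (j) nuj.
apply: (@le_trans _ _ (2 * V / pi * \sum_(j <= k < N) ((k ^_ nu.+1)%:R)^-1)).
  rewrite mulr_sumr big_nat [leRHS]big_nat; apply: ler_sum => k /andP[jk _].
  have nuk : (nu < k)%N by apply: leq_trans jk; exact: ltnW.
  have k0 : (k == 0%N) = false by rewrite gtn_eqF // (leq_ltn_trans _ nuk).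
  rewrite /cos_coef k0.
  rewrite normrM gtr0_norm ?divr_gt0 ?pi_gt0 // [2 * V / pi]mulrAC -[leRHS]mulrA.
  apply: ler_wpM2l; first by rewrite divr_ge0 // pi_ge0.
  exact: cos_moment_le.
rewrite -!mulrA ler_wpM2l // ler_wpM2l // invfM ler_wpM2l ?invr_ge0 ?pi_ge0 //.
apply: le_trans (sum_inv_ffact_le _ nu0 (ltnW nuj)) _.
rewrite jE !invfM ler_wpM2l ?invr_ge0 ?(ltW nuR) //.
rewrite -natrX lef_pV2 ?posrE ?ltr0n ?ffact_gt0 ?expn_gt0 ?jnu //; last first.
  by rewrite ltnW // -subn_gt0.
by rewrite ler_nat expn_le_ffact.
Qed.

End BoundedVariation.

(** * Functions with a locally uniform quadratic remainder *)

Section QuadDiff.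
Local Open Scope complex_scope.
Variable R : realType.
Implicit Types (z w : R[i]) (F G H : R[i] -> R[i]) (e r M : R).

Lemma normc_normr z : `|z| = (normc z)%:C.
Proof. by case: z. Qed.

Lemma normc_ge0 z : 0 <= normc z.
Proof. by rewrite -lecR -normc_normr normr_ge0. Qed.

Lemma ler_normcD z w : normc (z + w) <= normc z + normc w.
Proof. exact: le_normcD. Qed.

Lemma normcB z w : normc (z - w) = normc (w - z).
Proof. by rewrite -normcN opprB. Qed.

Lemma ler_normcB z w : normc (z - w) <= normc z + normc w.
Proof. by rewrite -[normc w]normcN; exact: ler_normcD. Qed.

Lemma normc_Re_le z : `|complex.Re z| <= normc z.
Proof. by rewrite -lecR -normc_normr; exact: normc_ge_Re. Qed.

Lemma normc_Im_le z : `|complex.Im z| <= normc z.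
Proof.
case: z => a b /=; rewrite -sqrtr_sqr ler_sqrt ?addr_ge0 ?sqr_ge0 //.
by rewrite lerDr sqr_ge0.
Qed.

Lemma normc_le z : normc z <= `|complex.Re z| + `|complex.Im z|.
Proof.
case: z => a b /=; rewrite -[leRHS]ger0_norm ?addr_ge0 // -[leRHS]sqrtr_sqr.
rewrite ler_sqrt ?sqr_ge0 // sqrrD !real_normK ?num_real //.
by rewrite -addrA lerD2l lerDr mulrn_wge0 // mulr_ge0.
Qed.

Lemma normc_real (x : R) : normc x%:C = `|x|.
Proof. by rewrite /= expr0n addr0 sqrtr_sqr. Qed.

Lemma normcX z n : normc (z ^+ n) = normc z ^+ n.
Proof.
elim: n => [|n IH]; first by rewrite !expr0 normc1.
by rewrite !exprS normcM IH.
Qed.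

(* Holomorphy at z0 in a quantitative form, uniform near z0; the constant M also
   bounds the derivative D, which makes the notion stable under composition. *)
Definition quad_diff H z0 := exists r M, [/\ 0 < r, 0 <= M &
  forall w, normc (w - z0) < r -> exists2 D, normc D <= M &
    forall z, normc (z - z0) < r ->
      normc (H z - H w - D * (z - w)) <= M * normc (z - w) ^+ 2].

Lemma quad_diff_lipschitz H z0 : quad_diff H z0 -> exists r L, [/\ 0 < r, 0 <= L &
  forall w z, normc (w - z0) < r -> normc (z - z0) < r ->
    normc (H z - H w) <= L * normc (z - w)].
Proof.
move=> [r [M [r0 M0 HD]]]; exists r, (M + M * (2 * r)); split => //.
  by rewrite addr_ge0 // !mulr_ge0 // ltW.
move=> w z wr zr; have [D DM Dz] := HD w wr.
have -> : H z - H w = (H z - H w - D * (z - w)) + D * (z - w) by ring.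
apply: le_trans (ler_normcD _ _) _; rewrite normcM.
have zw : normc (z - w) <= 2 * r.
  have -> : z - w = (z - z0) - (w - z0) by ring.
  by apply: le_trans (ler_normcB _ _) _; lra.
have := Dz z zr; have := normc_ge0 (z - w); have := normc_ge0 D.
set n := normc (z - w) in zw *; set d := normc D in DM *; set q := normc _.
move=> d0 n0 qn; rewrite mulrDl addrC lerD //; first exact: ler_wpM2r.
apply: le_trans qn _; rewrite expr2 [leLHS]mulrA; apply: ler_wpM2r => //;
  exact: ler_wpM2l.
Qed.

Lemma quad_diff_const c z0 : quad_diff (fun=> c) z0.
Proof.
exists 1, 0; split=> // w _; exists 0; first by rewrite normc0.
by move=> z _; rewrite subrr mul0r subrr normc0 mul0r.
Qed.

Lemma quad_diff_id z0 : quad_diff id z0.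
Proof.
exists 1, 1; split=> // w _; exists 1; first by rewrite normc1.
by move=> z _; rewrite mul1r subrr normc0 mul1r sqr_ge0.
Qed.

Lemma quad_diff_add F G z0 : quad_diff F z0 -> quad_diff G z0 ->
  quad_diff (fun z => F z + G z) z0.
Proof.
move=> [r1 [M1 [r10 M10 FD]]] [r2 [M2 [r20 M20 GD]]].
exists (Num.min r1 r2), (M1 + M2); split; rewrite ?lt_min ?r10 ?addr_ge0 // => w.
rewrite lt_min => /andP[w1 w2]; have [D1 D1M D1z] := FD w w1;
  have [D2 D2M D2z] := GD w w2.
exists (D1 + D2); first by apply: le_trans (ler_normcD _ _) _; exact: lerD.
move=> z; rewrite lt_min => /andP[z1 z2].
have -> : F z + G z - (F w + G w) - (D1 + D2) * (z - w)
  = (F z - F w - D1 * (z - w)) + (G z - G w - D2 * (z - w)) by ring.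
by apply: le_trans (ler_normcD _ _) _; rewrite mulrDl lerD ?D1z ?D2z.
Qed.

(** Besides the two remainders, the product leaves the term (F z - F w)(G z - G w), which is
    quadratic by the Lipschitz bounds. Capping the radius by 1 bounds F and G themselves by [BF] and
    [BG]. *)
Lemma quad_diff_mul F G z0 : quad_diff F z0 -> quad_diff G z0 ->
  quad_diff (fun z => F z * G z) z0.
Proof.
move=> qF qG; have [rf [Lf [rf0 Lf0 FL]]] := quad_diff_lipschitz qF.
have [rg [Lg [rg0 Lg0 GL]]] := quad_diff_lipschitz qG.
move: qF qG => [r1 [M1 [r10 M10 FD]]] [r2 [M2 [r20 M20 GD]]].
pose r := Num.min (Num.min r1 r2) (Num.min (Num.min rf rg) 1).
pose BF := normc (F z0) + Lf; pose BG := normc (G z0) + Lg.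
have BF0 : 0 <= BF by rewrite addr_ge0 ?normc_ge0.
have BG0 : 0 <= BG by rewrite addr_ge0 ?normc_ge0.
have inball z : normc (z - z0) < r -> [/\ normc (z - z0) < r1, normc (z - z0) < r2,
    normc (z - z0) < rf, normc (z - z0) < rg & normc (z - z0) < 1].
  by rewrite !lt_min => /andP[/andP[-> ->] /andP[/andP[-> ->] ->]].
have r0 : 0 < r by rewrite !lt_min r10 r20 rf0 rg0 ltr01.
have bnd (K : R[i] -> R[i]) rk Lk : 0 < rk -> 0 <= Lk ->
  (forall w z, normc (w - z0) < rk -> normc (z - z0) < rk ->
    normc (K z - K w) <= Lk * normc (z - w)) -> forall z, normc (z - z0) < rk ->
      normc (z - z0) < 1 ->
    normc (K z) <= normc (K z0) + Lk.
  move=> rk0 Lk0 KL z zr z1; have -> : K z = K z0 + (K z - K z0) by ring.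
  apply: le_trans (ler_normcD _ _) _; rewrite lerD2l.
  apply: le_trans (KL z0 z _ zr) _; first by rewrite subrr normc0.
  by rewrite ler_piMr // ltW.
exists r, (BF * M2 + BG * M1 + Lf * Lg); split => //.
  by rewrite !addr_ge0 // mulr_ge0.
move=> w /inball[w1 w2 wf wg wl]; have [D1 D1M D1z] := FD w w1;
  have [D2 D2M D2z] := GD w w2.
have Fw := bnd F _ _ rf0 Lf0 FL w wf wl; have Gw := bnd G _ _ rg0 Lg0 GL w wg wl.
exists (F w * D2 + G w * D1).
  apply: le_trans (ler_normcD _ _) _; rewrite !normcM -[leLHS]addr0.
  by rewrite !lerD ?mulr_ge0 // ler_pM // ?normc_ge0.
move=> z /inball[z1 z2 zf zg zl].
have -> : F z * G z - F w * G w - (F w * D2 + G w * D1) * (z - w) =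
  F w * (G z - G w - D2 * (z - w)) + G w * (F z - F w - D1 * (z - w))
  + (F z - F w) * (G z - G w) by ring.
apply: le_trans (ler_normcD _ _) _; rewrite [leRHS]mulrDl; apply: lerD.
  apply: le_trans (ler_normcD _ _) _; rewrite [leRHS]mulrDl !normcM -!mulrA.
  by apply: lerD; apply: ler_pM; rewrite ?normc_ge0 ?D1z ?D2z.
have := FL w z wf zf; have := GL w z wg zg; rewrite normcM => g1 f1.
rewrite expr2 mulrACA; apply: ler_pM => //; exact: normc_ge0.
Qed.

Lemma quad_diff_comp F p z0 : quad_diff p z0 -> quad_diff F (p z0) ->
  quad_diff (fun z => F (p z)) z0.
Proof.
move=> qp [r2 [M2 [r20 M20 FD]]]; have [rp [Lp [rp0 Lp0 pL]]] := quad_diff_lipschitz qp.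
move: qp => [r1 [M1 [r10 M10 pD]]].
(* The last radius makes p map the ball into the ball of radius r2; the + 1 keeps the denominator
   positive when Lp = 0. *)
pose r := Num.min (Num.min r1 rp) (r2 / (Lp + 1)).
have r0 : 0 < r by rewrite !lt_min r10 rp0 divr_gt0 // ltr_wpDl.
have inball z : normc (z - z0) < r -> [/\ normc (z - z0) < r1, normc (z - z0) < rp &
    normc (p z - p z0) < r2].
  rewrite !lt_min => /andP[/andP[-> zp] zr]; rewrite zp; split=> //.
  apply: le_lt_trans (pL z0 z _ zp) _; first by rewrite subrr normc0.
  rewrite ltr_pdivlMr ?ltr_wpDl // in zr; apply: le_lt_trans zr.
  by rewrite mulrC ler_wpM2l ?normc_ge0 // lerDl.
exists r, (M2 * M1 + M2 * Lp ^+ 2); split=> //.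
  by rewrite addr_ge0 ?mulr_ge0 ?sqr_ge0.
move=> w /inball[w1 wp w2]; have [D1 D1M D1z] := pD w w1; have [D2 D2M D2z] := FD _ w2.
exists (D2 * D1).
  rewrite normcM; apply: le_trans (ler_pM _ _ D2M D1M) _; rewrite ?normc_ge0 //.
  by rewrite lerDl mulr_ge0 // sqr_ge0.
move=> z /inball[z1 zp z2].
have -> : F (p z) - F (p w) - D2 * D1 * (z - w) =
  D2 * (p z - p w - D1 * (z - w)) + (F (p z) - F (p w) - D2 * (p z - p w)) by ring.
apply: le_trans (ler_normcD _ _) _; rewrite mulrDl; apply: lerD.
  by rewrite normcM -mulrA; apply: ler_pM; rewrite ?normc_ge0 ?D1z.
apply: le_trans (D2z _ z2) _; rewrite -mulrA ler_wpM2l // -exprMn.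
by rewrite ler_sqr ?nnegrE ?mulr_ge0 ?normc_ge0 // pL.
Qed.

Lemma quad_diff_inv z0 : z0 != 0 -> quad_diff (fun z => z^-1) z0.
Proof.
move=> z00; have n0 : 0 < normc z0.
  rewrite lt_neqAle normc_ge0 andbT eq_sym; apply: contra z00 => /eqP/eq0_normc ->.
  exact: eqxx.
pose a := normc z0 / 2; have a0 : 0 < a by rewrite divr_gt0.
have big z : normc (z - z0) < a -> a <= normc z.
  move=> za; have -> : a = normc z0 - a by rewrite /a; field.
  rewrite lerBlDr; have := ler_normcD z (z0 - z); rewrite subrKC => h.
  by apply: le_trans h _; rewrite lerD2l normcB ltW.
have nz z : normc (z - z0) < a -> z != 0.
  by move=> /big; apply: contraTneq => ->; rewrite normc0 -ltNge.
exists a, (a ^- 2 + a ^- 3); split=> //.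
  by rewrite addr_ge0 // invr_ge0 exprn_ge0 // ltW.
move=> w wa; have wb := big w wa; have w0 := nz w wa.
exists (- w ^- 2).
  rewrite normcN normcV normcX; apply: le_trans (_ : a ^- 2 <= _).
    by rewrite lef_pV2 ?posrE ?exprn_gt0 // ?(lt_le_trans a0) // ler_sqr ?nnegrE
      ?normc_ge0 ?(ltW a0).
  by rewrite lerDl invr_ge0 exprn_ge0 // ltW.
move=> z za; have zb := big z za; have z0' := nz z za.
(* The remainder is exactly (z - w)^2 / (z w^2), and both points have modulus at least a. *)
have -> : z^-1 - w^-1 - (- w ^- 2) * (z - w) = (z - w) ^+ 2 * (z * w ^+ 2)^-1.
  by field; rewrite z0' w0.
rewrite normcM normcX mulrC ler_wpM2r ?sqr_ge0 // normcV normcM normcX.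
apply: (@le_trans _ _ (a ^- 3)); last by rewrite lerDr invr_ge0 exprn_ge0 // ltW.
have zp : 0 < normc z by exact: lt_le_trans zb.
have wp : 0 < normc w by exact: lt_le_trans wb.
rewrite lef_pV2 ?posrE ?exprn_gt0 ?mulr_gt0 ?exprn_gt0 // exprS ler_pM ?sqr_ge0
  ?(ltW a0) //.
by rewrite ler_sqr ?nnegrE ?normc_ge0 ?(ltW a0).
Qed.

End QuadDiff.

(** * Power series have a locally uniform quadratic remainder *)

Section PowerSeries.
Local Open Scope complex_scope.
Variable R : realType.
Implicit Types (z w x y : R[i]) (d c : nat -> R[i]).

Lemma normc_sum (I : Type) (s : seq I) (P : pred I) (f : I -> R[i]) :
  normc (\sum_(i <- s | P i) f i) <= \sum_(i <- s | P i) normc (f i).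
Proof.
elim/big_ind2 : _ => //; first by rewrite normc0.
by move=> u a v b ua vb; apply: le_trans (ler_normcD _ _) _; exact: lerD.
Qed.

Lemma complex_series_cvg d (b : nat -> R) (B : R) : (forall n, normc (d n) <= b n) ->
  (forall N, \sum_(0 <= n < N) b n <= B) ->
  exists2 D, normc D <= B & forall e : R, 0 < e -> exists N0, forall N, (N0 <= N)%N ->
    normc (D - \sum_(0 <= n < N) d n) <= e.
Proof.
move=> db bB; have b0 n : 0 <= b n by exact: le_trans (normc_ge0 _) (db n).
have cb : cvgn (series b).
  apply: nondecreasing_is_cvgn; first exact: nondecreasing_series.
  by exists B => _ [N _ <-]; exact: bB.
have part (p : R[i] -> R) : (forall z, `|p z| <= normc z) -> cvgn (series (p \o d)).
  move=> pz; apply: normed_cvg; apply: series_le_cvg cb => [n|n|n] //=.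
  exact: le_trans (pz _) (db n).
have cr := part _ (@normc_Re_le R); have ci := part _ (@normc_Im_le R).
pose D := limn (series (@complex.Re R \o d)) +i* limn (series (@complex.Im R \o d)).
have DN e : 0 < e -> exists N0, forall N, (N0 <= N)%N ->
    normc (D - \sum_(0 <= n < N) d n) <= e.
  move=> e0; have e2 : 0 < e / 2 by rewrite divr_gt0.
  have [N1 _ HN1] := cvgr_dist_le _ _ cr _ e2.
  have [N2 _ HN2] := cvgr_dist_le _ _ ci _ e2.
  exists (maxn N1 N2) => N; rewrite geq_max => /andP[/HN1/= n1 /HN2/= n2].
  have E : \sum_(0 <= n < N) d n = series (@complex.Re R \o d) N +i* series
    (@complex.Im R \o d) N.
    rewrite /series /=; elim: N {n1 n2} => [|N IH]; first by rewrite !big_geq.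
    by rewrite !big_nat_recr //= IH; case: (d N).
  rewrite E; apply: le_trans (normc_le _) _ => /=; rewrite [e]splitr.
  exact: lerD.
exists D => //; apply/ler_addgt0Pr => e e0; have [N HN] := DN e e0.
have := HN N (leqnn N); set s := \sum_(0 <= n < N) _ => Ds.
have -> : D = s + (D - s) by ring.
apply: le_trans (ler_normcD _ _) _; apply: lerD => //.
apply: le_trans (normc_sum _ _ _) _; apply: le_trans (bB N).
by apply: ler_sum => n _; exact: db.
Qed.

(** The factor q^2 on the left avoids the exponent n - 2, which would be wrong for n < 2. The
    induction multiplies the previous remainder by x and adds n y^(n-1) (x - y)^2; it closes because
    n^2 + n <= (n + 1)^2. *)
Lemma normc_taylor_expn x y (q : R) n : normc x <= q -> normc y <= q ->
  normc (x ^+ n - y ^+ n - n%:R * y ^+ n.-1 * (x - y)) * q ^+ 2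
    <= n%:R ^+ 2 * q ^+ n * normc (x - y) ^+ 2.
Proof.
move=> xq yq; have q0 : 0 <= q by exact: le_trans (normc_ge0 _) xq.
have n0 := normc_ge0 (x - y); set u := normc (x - y) in n0 *.
elim: n => [|n IH].
  by rewrite !expr0 subrr mul0r mul0r subrr normc0 mul0r expr0n !mul0r.
have nq : normc (n%:R * y ^+ n.-1) * q <= n%:R * q ^+ n.
  have -> : normc (n%:R * y ^+ n.-1) = n%:R * normc y ^+ n.-1.
    by rewrite normcM normcX -(rmorph_nat (real_complex R)) normc_real ger0_norm.
  case: n {IH} => [|n] /=; first by rewrite !mul0r.
  rewrite -mulrA ler_wpM2l //;
    by rewrite exprSr ler_wpM2r // lerXn2r // nnegrE normc_ge0.
have -> : x ^+ n.+1 - y ^+ n.+1 - n.+1%:R * y ^+ n.+1.-1 * (x - y)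
  = x * (x ^+ n - y ^+ n - n%:R * y ^+ n.-1 * (x - y)) + n%:R * y ^+ n.-1
    * (x - y) ^+ 2.
  rewrite /= -natr1; case: n {IH nq} => [|n]; first by rewrite !expr0 expr1; ring.
  by rewrite /= !exprS; ring.
set E := x ^+ n - _ - _ in IH *.
have E0 := normc_ge0 E.
apply: (@le_trans _ _ (q * (normc E * q ^+ 2) + (normc (n%:R * y ^+ n.-1) * q) * q
  * u ^+ 2)).
  have := ler_normcD (x * E) (n%:R * y ^+ n.-1 * (x - y) ^+ 2).
  rewrite normcM [normc (_ * (x - y) ^+ 2)]normcM normcX -/u => h.
  apply: le_trans (ler_wpM2r (sqr_ge0 q) h) _; rewrite mulrDl; apply: lerD.
    by rewrite -mulrA ler_wpM2r // mulr_ge0 ?sqr_ge0.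
  by rewrite le_eqVlt; apply/orP; left; apply/eqP; ring.
apply: (@le_trans _ _ (q * (n%:R ^+ 2 * q ^+ n * u ^+ 2) + (n%:R * q ^+ n) * q
  * u ^+ 2)).
  by apply: lerD; [exact: ler_wpM2l|rewrite ler_wpM2r ?sqr_ge0 // ler_wpM2r].
rewrite [q ^+ n.+1]exprS -natr1 -subr_ge0.
have -> : (n%:R + 1) ^+ 2 * (q * q ^+ n) * u ^+ 2
  - (q * (n%:R ^+ 2 * q ^+ n * u ^+ 2) + n%:R * q ^+ n * q * u ^+ 2)
  = (n%:R + 1) * (q * q ^+ n * u ^+ 2) by ring.
by rewrite !mulr_ge0 ?addr_ge0 ?sqr_ge0 ?exprn_ge0.
Qed.

Lemma sqr_le_expn2 n : (n ^ 2 <= 2 * 2 ^ n)%N.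
Proof.
elim: n => // n IH; case: n IH => [|[|[|n]]] // IH.
rewrite expnS; have := IH; rewrite !expnS !expn0 !muln1; nia.
Qed.

(** Coefficients are controlled at radius r/2 and used at q = r/8, which leaves a factor 4^-n. One
    half of it, 2^-n, absorbs the n^2 of the Taylor remainder, the other sums geometrically. D is
    the termwise derivative; the summands of M bound D and the remainder. *)
Lemma power_series_quad_diff (F : R[i] -> R[i]) c z0 (r : R) : 0 < r ->
  (forall z, normc (z - z0) < r -> forall e : R, 0 < e -> exists N0, forall N,
    (N0 <= N)%N ->
    normc (F z - \sum_(0 <= n < N) c n * (z - z0) ^+ n) <= e) ->
  quad_diff F z0.
Proof.
move=> r0 Fc; pose q := r / 8; have q0 : 0 < q by rewrite divr_gt0.
(* Convergence at a point at distance r/2 bounds the terms there: past N0 a term is a difference of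
   two errors at most 1, whence the 2; the earlier terms are covered by their sum. *)
have [B B0 cB] : exists2 B : R, 0 <= B & forall n, normc (c n) * (r / 2) ^+ n <= B.
  pose t := z0 + (r / 2)%:C.
  have t0 : t - z0 = (r / 2)%:C by rewrite /t addrC addKr.
  have nt : normc (t - z0) = r / 2
    by rewrite t0 normc_real ger0_norm // divr_ge0 // ltW.
  have [|N0 HN] := Fc t _ 1 ltr01; first by rewrite nt; lra.
  exists (2 + \sum_(0 <= n < N0) normc (c n) * (r / 2) ^+ n).
    by rewrite addr_ge0 // sumr_ge0 // => n _;
      rewrite mulr_ge0 ?normc_ge0 // exprn_ge0 // divr_ge0 // ltW.
  have tn n : normc (c n * (t - z0) ^+ n) = normc (c n) * (r / 2) ^+ n.
    by rewrite normcM normcX nt.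
  have tn0 n : 0 <= normc (c n) * (r / 2) ^+ n by rewrite -tn normc_ge0.
  move=> n; have [nN|nN] := ltnP n N0.
    rewrite (big_cat_nat (leq0n n) (ltnW nN)) /= (big_ltn nN).
    have s1 : 0 <= \sum_(0 <= i < n) normc (c i) * (r / 2) ^+ i by apply: sumr_ge0.
    have s2 : 0 <= \sum_(n.+1 <= i < N0) normc (c i) * (r / 2) ^+ i by apply: sumr_ge0.
    lra.
  have h1 := HN n nN; have h2 := HN n.+1 (leqW nN).
  rewrite -tn; set S := \sum_(0 <= i < n) _ in h1.
  have -> : c n * (t - z0) ^+ n = (F t - S)
    - (F t - \sum_(0 <= i < n.+1) c i * (t - z0) ^+ i).
    by rewrite big_nat_recr //= -/S; ring.
  have s1 : 0 <= \sum_(0 <= i < N0) normc (c i) * (r / 2) ^+ i by apply: sumr_ge0.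
  by apply: le_trans (ler_normcB _ _) _; lra.
have cq n : normc (c n) * q ^+ n * n%:R ^+ 2 <= 2 * B * 2^-1 ^+ n.
  have -> : q = r / 2 * 2^-1 ^+ 2 by rewrite /q; field.
  rewrite exprMn exprAC.
  have n2 : n%:R ^+ 2 <= 2 * 2 ^+ n :> R by rewrite -!natrX -natrM ler_nat sqr_le_expn2.
  have h0 : 0 <= 2^-1 ^+ n :> R by rewrite exprn_ge0 // invr_ge0.
  have h1 : 2^-1 ^+ n * 2 ^+ n = 1 :> R by rewrite -exprMn mulVf // expr1n.
  have := cB n; have := normc_ge0 (c n); set a := normc (c n) => a0 aB.
  have -> : a * ((r / 2) ^+ n * (2^-1 ^+ n) ^+ 2) * n%:R ^+ 2
    = a * (r / 2) ^+ n * 2^-1 ^+ n * (2^-1 ^+ n * n%:R ^+ 2) by ring.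
  apply: (@le_trans _ _ (B * 2^-1 ^+ n * (2^-1 ^+ n * (2 * 2 ^+ n)))).
    apply: ler_pM.
    - by rewrite mulr_ge0 // mulr_ge0 // exprn_ge0 // divr_ge0 // ltW.
    - by rewrite mulr_ge0 // sqr_ge0.
    - by rewrite ler_wpM2r.
    - by rewrite ler_wpM2l.
  have -> : B * 2^-1 ^+ n * (2^-1 ^+ n * (2 * 2 ^+ n)) = 2 * B * 2^-1 ^+ n
    * (2^-1 ^+ n * 2 ^+ n) by ring.
  by rewrite h1 mulr1.
have sum_half N : \sum_(0 <= n < N) 2^-1 ^+ n <= 2 :> R.
  suff -> : \sum_(0 <= n < N) 2^-1 ^+ n = 2 - 2 * 2^-1 ^+ N :> R.
    by rewrite lerBlDr lerDl mulr_ge0 // exprn_ge0 // invr_ge0.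
  elim: N => [|N IH]; first by rewrite big_geq // expr0; ring.
  by rewrite big_nat_recr //= IH exprS; field.
pose M := 4 * B / q + 4 * B / q ^+ 2.
have M0 : 0 <= M by rewrite addr_ge0 // divr_ge0 ?mulr_ge0 ?exprn_ge0 // ltW.
exists q, M; split => // w wq.
pose y := w - z0; pose d n := c n * (n%:R * y ^+ n.-1).
have [D DB DN] : exists2 D, normc D <= 4 * B / q & forall e : R, 0 < e -> exists N0,
  forall N, (N0 <= N)%N ->
    normc (D - \sum_(0 <= n < N) d n) <= e.
  apply: (@complex_series_cvg _ (fun n => 2 * B / q * 2^-1 ^+ n)) => [n|N]; last first.
    rewrite -mulr_sumr; apply: le_trans (ler_wpM2l _ (sum_half N)) _.
      by rewrite divr_ge0 ?mulr_ge0 // ltW.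
    by rewrite mulrAC; lra.
  rewrite mulrAC ler_pdivlMr //; apply: le_trans (cq n).
  rewrite /d !normcM normcX -!mulrA ler_wpM2l ?normc_ge0 //.
  have -> : normc (n%:R : R[i]) = n%:R :> R.
    by rewrite -(rmorph_nat (real_complex R)) normc_real ger0_norm.
  case: n => [|n]; first by rewrite !mul0r expr0n mulr0.
  rewrite [q ^+ _ * _]mulrC [q ^+ _]exprSr; apply: ler_pM => //.
  - by rewrite mulr_ge0 ?exprn_ge0 ?normc_ge0 // ltW.
  - by rewrite expr2 ler_peMl // ler1n.
  - by rewrite ler_wpM2r ?(ltW q0) // lerXn2r ?nnegrE ?normc_ge0 ?(ltW q0) // ltW.
exists D; first by apply: le_trans DB _;
  rewrite lerDl divr_ge0 ?mulr_ge0 ?exprn_ge0 // ltW.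
move=> z zq; pose x := z - z0; have xy : x - y = z - w by rewrite /x /y; ring.
set u := normc (z - w); have u0 : 0 <= u by exact: normc_ge0.
(* Truncation costs e' for F z, e' for F w and e' u for D (z - w), in total e. *)
apply/ler_addgt0Pr => e e0; pose e' := e / (2 + u).
have e'0 : 0 < e' by rewrite divr_gt0 // ltr_wpDr.
have qr : q < r by rewrite /q; lra.
have [N1 HN1] := Fc z (lt_trans zq qr) _ e'0;
  have [N2 HN2] := Fc w (lt_trans wq qr) _ e'0.
have [N3 HN3] := DN _ e'0; pose N := maxn N1 (maxn N2 N3).
have {HN1} h1 := HN1 N (leq_maxl _ _).
have {HN2} h2 := HN2 N (leq_trans (leq_maxl _ _) (leq_maxr _ _)).
have {HN3} h3 := HN3 N (leq_trans (leq_maxr _ _) (leq_maxr _ _)).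
rewrite -/x in h1; rewrite -/y in h2.
set Sz := \sum_(0 <= n < N) _ in h1; set Sw := \sum_(0 <= n < N) _ in h2.
set DS := \sum_(0 <= n < N) _ in h3.
have SE : Sz - Sw - DS * (x - y) = \sum_(0 <= n < N) c n
  * (x ^+ n - y ^+ n - n%:R * y ^+ n.-1 * (x - y)).
  rewrite /Sz /Sw /DS mulr_suml -!sumrB; apply: eq_bigr => n _.
  by rewrite /d; ring.
have -> : F z - F w - D * (z - w) = (Sz - Sw - DS * (x - y))
  + ((F z - Sz) - (F w - Sw) - (D - DS) * (z - w)).
  by rewrite xy; ring.
apply: le_trans (ler_normcD _ _) _; apply: lerD.
  rewrite SE; apply: le_trans (normc_sum _ _ _) _.
  apply: (@le_trans _ _ (\sum_(0 <= n < N) 2 * B / q ^+ 2 * u ^+ 2 * 2^-1 ^+ n)).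
    apply: ler_sum => n _; rewrite normcM.
    have := normc_taylor_expn n (ltW zq) (ltW wq); rewrite -/x -/y xy -/u.
    set E := normc (_ - _ - _) => hE; have E0 : 0 <= E by exact: normc_ge0.
    have -> : 2 * B / q ^+ 2 * u ^+ 2 * 2^-1 ^+ n = 2 * B * 2^-1 ^+ n * u ^+ 2 / q ^+ 2
      by ring.
    rewrite ler_pdivlMr ?exprn_gt0 // -[leLHS]mulrA.
    apply: le_trans (ler_wpM2l (normc_ge0 _) hE) _.
    have -> : normc (c n) * (n%:R ^+ 2 * q ^+ n * u ^+ 2) = normc (c n) * q ^+ n
      * n%:R ^+ 2 * u ^+ 2 by ring.
    by rewrite ler_wpM2r ?sqr_ge0.
  rewrite -mulr_sumr; apply: le_trans (ler_wpM2l _ (sum_half N)) _.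
    by rewrite mulr_ge0 ?sqr_ge0 // divr_ge0 ?mulr_ge0 ?exprn_ge0 // ltW.
  rewrite mulrAC ler_wpM2r ?sqr_ge0 // /M.
  have : 0 <= 4 * B / q by rewrite divr_ge0 ?mulr_ge0 // ltW.
  by rewrite [2 * B / _ * 2]mulrAC; lra.
have := ler_normcB ((F z - Sz) - (F w - Sw)) ((D - DS) * (z - w)).
have := ler_normcB (F z - Sz) (F w - Sw); rewrite normcM -/u => k1 k2.
have k3 : normc (D - DS) * u <= e' * u by rewrite ler_wpM2r.
have : e' * (2 + u) = e by rewrite divfK // gt_eqF // ltr_wpDr.
by lra.
Qed.

End PowerSeries.

(** * Integrals over circles *)

Section Circle.
Local Open Scope complex_scope.
Variable R : realType.
Implicit Types (z w : R[i]) (H : R[i] -> R[i]) (t u h r : R).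

Definition cis t : R[i] := cos t +i* sin t.

Lemma cisD t u : cis (t + u) = cis t * cis u.
Proof. by rewrite /cis cosD sinD; simpc; congr (_ +i* _); rewrite addrC. Qed.

Lemma normc_cis t : normc (cis t) = 1.
Proof. by rewrite /= cos2Dsin2 sqrtr1. Qed.

Lemma sin_lipschitz t u : `|sin t - sin u| <= `|t - u|.
Proof.
rewrite -[sin t]cosBpihalf -[sin u]cosBpihalf; apply: le_trans (cos_lipschitz _ _) _.
by rewrite opprB addrA subrK.
Qed.

Lemma cis_lipschitz t u : normc (cis t - cis u) <= 2 * `|t - u|.
Proof.
apply: le_trans (normc_le _) _ => /=.
have := cos_lipschitz t u; have := sin_lipschitz t u; lra.
Qed.

Lemma cis_taylor h : normc (cis h - 1 - h%:C * 'i) <= 2 * h ^+ 2.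
Proof.
have bnd (f : R -> R) (g : R -> R) : (forall t, is_derive t 1 f (g t)) ->
    (forall t, `|t| <= `|h| -> `|g t| <= `|h|) -> `|f h - f 0| <= h ^+ 2.
  move=> df gh; rewrite -real_normK ?num_real // expr2.
  have cf a b : {within `[a, b], continuous f}.
    by apply: derivable_within_continuous => t _; case: (df t).
  have [h0|h0] := leP 0 h.
    have [c cI ->] := MVT_segment h0 (fun t _ => df t) (cf _ _).
    rewrite normrM subr0 ler_wpM2r // gh //; rewrite in_itv /= in cI.
    by case/andP: cI => c0 ch; rewrite !ger0_norm.
  have [c cI] := MVT_segment (ltW h0) (fun t _ => df t) (cf _ _).
  rewrite distrC => ->; rewrite normrM sub0r normrN ler_wpM2r // gh //.
  rewrite in_itv /= in cI; case/andP: cI => c0 ch.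
  by rewrite !ler0_norm ?lerN2 // ltW.
have c1 : `|cos h - 1| <= h ^+ 2.
  rewrite -[X in `|_ - X|](@cos0 R);
    apply: (bnd cos (fun t => - sin t) (@is_derive_cos R)) => t.
  by rewrite normrN; apply: le_trans; have := sin_lipschitz t 0; rewrite sin0 !subr0.
have c2 : `|sin h - h| <= h ^+ 2.
  have -> : sin h - h = (sin h - 1 * h) - (sin 0 - 1 * 0) by rewrite sin0; ring.
  have df t : is_derive t 1 (fun t => sin t - 1 * t) (cos t - 1).
    exact: is_derive_sub (is_derive_sin t) (is_derive_linear 1 t).
  apply: (bnd _ _ df) => t.
  by apply: le_trans; have := cos_lipschitz t 0; rewrite cos0 subr0.
apply: le_trans (normc_le _) _ => /=;
  rewrite !(mulr0, mul0r, mulr1, subr0, add0r, addr0, oppr0).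
by lra.
Qed.

(** The dilation moves w by h w and the rotation by i h w up to O(h^2), so i times the radial
    increment of H agrees with the angular increment to second order. Compactness of [0, 2 pi] makes
    the constant uniform. *)
Lemma circle_cauchy_riemann H r0 : 0 < r0 ->
  (forall t, quad_diff H (r0%:C * cis t)) ->
  exists n : nat, forall t, 0 <= t <= 2 * pi -> forall h, n%:R * `|h| <= 1 ->
    normc ('i * (H ((r0 * (1 + h))%:C * cis t) - H (r0%:C * cis t))
           - (H (r0%:C * cis (t + h)) - H (r0%:C * cis t))) <= n%:R * h ^+ 2.
Proof.
move=> r00 qH.
(* One integer n bounds both the admissible range of h and the constant, so that the covering form
   of compactness, with n tending to infinity, yields a common n. *)
pose P (n : nat) t := forall h, n%:R * `|h| <= 1 ->
    normc ('i * (H ((r0 * (1 + h))%:C * cis t) - H (r0%:C * cis t))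
           - (H (r0%:C * cis (t + h)) - H (r0%:C * cis t))) <= n%:R * h ^+ 2.
have := @segment_compact R 0 (2 * pi); rewrite compact_near_coveringP => nc.
suff /nc : forall t, `[0, 2 * pi]%classic t -> \forall u \near t & n \near \oo, P n u.
  case=> N _ HN; exists N => t tI; apply: (HN N (leqnn N)).
  by rewrite /= in_itv.
move=> t0 _; have [r [M [rr0 M0 HD]]] := qH t0.
(* The terms are the remainder under dilation, the remainder under rotation (where the displacement
   is at most 2 r0 |h|), and D times the Taylor error of [cis h]. *)
pose C0 := M * r0 ^+ 2 + M * (4 * r0 ^+ 2) + M * (2 * r0).
have nw t : normc (r0%:C * cis t - r0%:C * cis t0) <= 2 * r0 * `|t - t0|.
  rewrite -mulrBr normcM normc_real gtr0_norm // [2 * r0]mulrC -mulrA.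
  by rewrite ler_wpM2l ?cis_lipschitz // ltW.
have T1 : \forall t \near t0, `|t - t0| < r / (4 * r0).
  have d0 : 0 < r / (4 * r0) by rewrite divr_gt0 // mulr_gt0.
  apply/nbhs_ballP; exists (r / (4 * r0)) => // t.
  by rewrite /ball /= distrC.
have T2 : \forall n \near \oo, 4 * r0 / r + C0 <= n%:R by exact: nbhs_infty_ger.
near=> t n => h nh.
have tt : `|t - t0| < r / (4 * r0) by near: t.
have nC : 4 * r0 / r + C0 <= n%:R by near: n.
have C00 : 0 <= C0 by rewrite !addr_ge0 ?mulr_ge0 ?sqr_ge0 // ltW.
have h_le : r0 * `|h| <= r / 4.
  have : 4 * r0 / r * `|h| <= 1.
    by apply: le_trans nh; rewrite ler_wpM2r //; apply: le_trans nC; rewrite lerDl.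
  by rewrite mulrAC ler_pdivrMr // mul1r ler_pdivlMr //; lra.
set w := r0%:C * cis t; set z1 := (r0 * (1 + h))%:C * cis t;
  set z2 := r0%:C * cis (t + h).
have nwt : normc w = r0 by rewrite normcM normc_cis normc_real mulr1 gtr0_norm.
have wz0 : normc (w - r0%:C * cis t0) < r / 2.
  apply: le_lt_trans (nw t) _; rewrite ltr_pdivlMr ?mulr_gt0 // in tt; lra.
have z1w : z1 - w = h%:C * w.
  rewrite /z1 /w rmorphM rmorphD rmorph1; ring.
have z2w : z2 - w = (cis h - 1) * w by rewrite /z2 /w cisD; ring.
have h2 : normc (cis h - 1) <= 2 * `|h|.
  have := cis_lipschitz h 0; rewrite subr0; have -> // : cis 0 = 1.
  by rewrite /cis cos0 sin0.
have n1 : normc (z1 - w) = r0 * `|h| by rewrite z1w normcM nwt normc_real mulrC.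
have n2 : normc (z2 - w) <= 2 * r0 * `|h|.
  by rewrite z2w normcM nwt -[leRHS]mulrA [r0 * _]mulrC [leRHS]mulrA ler_wpM2r // ltW.
have inb z : normc (z - w) <= r / 2 -> normc (z - r0%:C * cis t0) < r.
  move=> zw; have -> : z - r0%:C * cis t0 = (z - w) + (w - r0%:C * cis t0) by ring.
  by apply: le_lt_trans (ler_normcD _ _) _; lra.
have [|D DM Dz] := HD w; first by apply: lt_trans wz0 _; lra.
have e1 := Dz z1 (inb z1 _); have e2 := Dz z2 (inb z2 _).
have {}e1 : normc (H z1 - H w - D * (z1 - w)) <= M * r0 ^+ 2 * h ^+ 2.
  rewrite -mulrA -[h ^+ 2]real_normK ?num_real // -exprMn -n1; apply: e1.
  by rewrite n1; lra.
have {}e2 : normc (H z2 - H w - D * (z2 - w)) <= M * (4 * r0 ^+ 2) * h ^+ 2.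
  apply: le_trans (e2 _) _; first by apply: le_trans n2 _; lra.
  rewrite -[h ^+ 2]real_normK ?num_real //.
  have -> : M * (4 * r0 ^+ 2) * `|h| ^+ 2 = M * (2 * r0 * `|h|) ^+ 2 by ring.
  by rewrite ler_wpM2l // lerXn2r ?nnegrE ?normc_ge0 // (le_trans _ n2) // normc_ge0.
have -> : 'i * (H z1 - H w) - (H z2 - H w) =
   'i * (H z1 - H w - D * (z1 - w)) - (H z2 - H w - D * (z2 - w))
   - D * ((cis h - 1 - h%:C * 'i) * w).
  by rewrite z1w z2w; ring.
apply: le_trans (ler_normcB _ _) _; apply: (@le_trans _ _ (C0 * h ^+ 2)); last first.
  rewrite ler_wpM2r ?sqr_ge0 //; apply: le_trans nC; rewrite lerDr.
  by rewrite divr_ge0 ?mulr_ge0 // ltW.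
rewrite /C0 [leRHS]mulrDl; apply: lerD.
  apply: le_trans (ler_normcB _ _) _; rewrite [leRHS]mulrDl; apply: lerD => //.
  by rewrite normcM /= expr0n expr1n add0r sqrtr1 mul1r.
rewrite normcM [normc (_ * w)]normcM nwt mulrA.
have -> : M * (2 * r0) * h ^+ 2 = M * (2 * h ^+ 2) * r0 by ring.
by rewrite ler_wpM2r ?(ltW r00) // ler_pM ?normc_ge0 ?cis_taylor.
Unshelve. all: by end_near. Qed.

End Circle.

(** * Circle integrals do not depend on the radius *)

Section CircleIntegral.
Local Open Scope complex_scope.
Variable R : realType.
Implicit Types (z w : R[i]) (F H : R[i] -> R[i]) (t u h r : R) (f q : R -> R).

Lemma derive0_eq f (a b : R) : a <= b ->
  (forall t, a <= t <= b -> is_derive t 1 f 0) -> f a = f b.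
Proof.
move=> ab df; have df' t : t \in `[a, b] -> is_derive t 1 f ((fun=> 0) t).
  by rewrite in_itv /=; exact: df.
have cf : {within `[a, b], continuous f}.
  by apply: derivable_within_continuous => t /df'[].
have [c _ /eqP] := MVT_segment ab (fun t tI => df' t (subset_itv_oo_cc tI)) cf.
by rewrite mul0r subr_eq0 => /eqP.
Qed.

(** For an antiderivative G, periodicity of q makes G(u + 2 pi) - G(u) constant in u. G is built on
    a larger interval to leave room for shifts by at most 1. *)
Lemma segint_shift q h : continuous q -> (forall t, q (t + 2 * pi) = q t) ->
  `|h| <= 1 -> segint 0 (2 * pi) (fun t => q (t + h)) = segint 0 (2 * pi) q.
Proof.
move=> cq qp h1; have p0 : 0 < 2 * pi :> R by rewrite mulr_gt0 // pi_gt0.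
have [G dG] := antiderivative_exists (2 * pi + 2) cq.
move: h1; rewrite ler_norml => /andP[hN1 h1].
have dG' t : -2 < t < 2 * pi + 2 -> is_derive t 1 G (q t).
  by move=> /andP[t1 t2]; apply: dG; rewrite ltr_norml; lra.
have ds (c u : R) : is_derive u 1 (fun t => t + c) 1.
  rewrite -[X in is_derive _ _ _ X]addr0.
  exact: is_derive_add (is_derive_id _ _) (is_derive_cst _ _ _).
have dGc (c u : R) : -2 < u + c < 2 * pi + 2 ->
  is_derive u 1 (fun t => G (t + c)) (q (u + c)).
  by move=> /dG' dGu; rewrite -[X in is_derive _ _ _ X]mulr1;
    exact: (is_derive_comp (g := fun t => t + c) dGu (ds c u)).
have dG0 t : 0 <= t <= 2 * pi -> is_derive t 1 G (q t).
  by move=> /andP[t1 t2]; apply: dG'; lra.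
have dGh t : 0 <= t <= 2 * pi -> is_derive t 1 (fun t => G (t + h)) (q (t + h)).
  by move=> /andP[t1 t2]; apply: dGc; lra.
have cqh : continuous (fun t => q (t + h)).
  move=> t; apply: (@continuous_comp _ _ _ (fun t => t + h) q); last exact: cq.
  exact: is_derive_continuous (ds h t).
rewrite (segint_FTC p0 cq dG0) (segint_FTC p0 cqh dGh).
pose K u := G (u + 2 * pi) - G (u + 0).
have dK u : -1 <= u <= 1 -> is_derive u 1 K 0.
  move=> /andP[u1 u2]; have -> : 0 = q (u + 2 * pi) - q (u + 0)
    by rewrite qp addr0 subrr.
  by apply: is_derive_sub; apply: dGc; have := pi_gt0 R; lra.
have KE : K h = K 0.
  have [h0|h0] := leP 0 h.
    by apply/esym/derive0_eq => // u /andP[u1 u2]; apply: dK; lra.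
  by apply: derive0_eq => [|u /andP[u1 u2]]; [exact: ltW|apply: dK; lra].
by move: KE; rewrite /K !addr0 !add0r [h + _]addrC.
Qed.

Lemma circle_modulus H r t0 (e : R) : 0 < r -> quad_diff H (r%:C * cis t0) -> 0 < e ->
  \forall t \near t0, normc (H (r%:C * cis t0) - H (r%:C * cis t)) <= e.
Proof.
move=> r0 qH e0; have [d [L [d0 L0 HL]]] := quad_diff_lipschitz qH.
have nw t : normc (r%:C * cis t0 - r%:C * cis t) <= 2 * r * `|t0 - t|.
  rewrite -mulrBr normcM normc_real gtr0_norm // [2 * r]mulrC -mulrA.
  by rewrite ler_wpM2l ?cis_lipschitz // ltW.
have L1 : 0 < L + 1 by rewrite ltr_wpDl.
pose k := Num.min d (e / (L + 1)) / (2 * r).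
have m0 : 0 < Num.min d (e / (L + 1)) by rewrite lt_min d0 divr_gt0.
have k0 : 0 < k by rewrite divr_gt0 // mulr_gt0.
apply/nbhs_ballP; exists k => // t; rewrite /ball /= => tk.
have small : normc (r%:C * cis t0 - r%:C * cis t) < Num.min d (e / (L + 1)).
  apply: le_lt_trans (nw t) _; rewrite ltr_pdivlMr ?mulr_gt0 // in tk.
  by rewrite mulrC.
move: small; rewrite lt_min => /andP[s1 s2].
apply: le_trans (HL _ _ _ _) _; rewrite ?subrr ?normc0 //; first by rewrite normcB.
apply: (@le_trans _ _ (L * (e / (L + 1)))); first by rewrite ler_wpM2l // ltW.
by rewrite mulrCA ler_piMr ?(ltW e0) // ler_pdivrMr // mul1r lerDl.
Qed.

Lemma continuous_circle H r (p : R[i] -> R) : (forall z w, p (z - w) = p z - p w) ->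
  (forall z, `|p z| <= normc z) -> 0 < r -> (forall t, quad_diff H (r%:C * cis t)) ->
  continuous (fun t => p (H (r%:C * cis t))).
Proof.
move=> pB pn r0 qH t; apply/cvgrPdist_le => e e0.
have := circle_modulus r0 (qH t) e0; apply: filterS => u; apply: le_trans.
by rewrite -pB; exact: pn.
Qed.

Lemma ReB z w : complex.Re (z - w) = complex.Re z - complex.Re w.
Proof. by case: z; case: w. Qed.

Lemma ImB z w : complex.Im (z - w) = complex.Im z - complex.Im w.
Proof. by case: z; case: w. Qed.

(** The real part is enough: on the unit circle, for the functions [laurent] below, it is the
    integrand of a cosine moment. *)
Definition circle_int H r := segint 0 (2 * pi) (fun t => complex.Re (H (r%:C * cis t))).

(* Rotating by h leaves the integral of the imaginary part unchanged, so the
   Cauchy-Riemann estimate shows that dilating by 1 + h changes the integral of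
   the real part by O(h^2). *)
Lemma circle_int_derive H (r1 r2 r0 : R) : 0 < r1 -> r1 < r0 < r2 ->
  (forall r t, r1 < r < r2 -> quad_diff H (r%:C * cis t)) ->
  is_derive r0 1 (circle_int H) 0.
Proof.
move=> r10 /andP[r1r0 r0r2] qH; have r00 : 0 < r0 by exact: lt_trans r1r0.
have q0 t : quad_diff H (r0%:C * cis t) by apply: qH; rewrite r1r0.
have [n CR] := circle_cauchy_riemann r00 q0.
have p0 : 0 < 2 * pi :> R by rewrite mulr_gt0 // pi_gt0.
have cRe r : r1 < r < r2 -> continuous (fun t => complex.Re (H (r%:C * cis t))).
  move=> rI; apply: continuous_circle; [exact: ReB|exact: normc_Re_le| |].
    by case/andP: rI => + _; exact: lt_trans.
  by move=> t; exact: qH.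
have cIm : continuous (fun t => complex.Im (H (r0%:C * cis t))).
  by apply: continuous_circle; [exact: ImB|exact: normc_Im_le| |].
have key h : n%:R * `|h| <= 1 -> `|h| <= 1 -> r1 < r0 * (1 + h) < r2 ->
    `|circle_int H (r0 * (1 + h)) - circle_int H r0| <= n%:R * h ^+ 2 * (2 * pi).
  move=> nh h1 rh; rewrite /circle_int -segintB;
    [|exact: cRe|by apply: cRe; rewrite r1r0].
  pose q t := complex.Im (H (r0%:C * cis t)).
  have qp t : q (t + 2 * pi) = q t.
    by rewrite /q /cis mulr_natl mulr2n addrA !cosDpi !sinDpi !opprK.
  have cqh : continuous (fun t => q (t + h)).
    move=> t; apply: (@continuous_comp _ _ _ (fun t => t + h) q); last exact: cIm.
    by apply: continuous_add => x; [exact: cvg_id|exact: cst_continuous].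
  set A := segint _ _ _.
  (* Subtracting q(t + h) - q(t), whose integral is zero, turns the integrand into the imaginary
     part of the Cauchy-Riemann expression. *)
  have -> : A = segint 0 (2 * pi) (fun t => complex.Re (H ((r0 * (1 + h))%:C * cis t))
    - complex.Re (H (r0%:C * cis t))
      - (q (t + h) - q t)).
    rewrite segintB; [|apply: continuous_sub; apply: cRe => //;
      by rewrite r1r0|exact: continuous_sub].
    by rewrite [X in _ - X]segintB // segint_shift // subrr subr0.
  have -> : n%:R * h ^+ 2 * (2 * pi) = n%:R * h ^+ 2 * (2 * pi - 0) by rewrite subr0.
  apply: segint_norm_le; first exact: ltW.
    apply: continuous_sub; last exact: continuous_sub.
    by apply: continuous_sub; apply: cRe => //; rewrite r1r0.
  move=> t tI; apply: le_trans (CR t tI h nh); apply: le_trans (normc_Im_le _).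
  rewrite /q; case: (H _) (H _) (H _) => [a b] [c d] [a' b'] /=.
  by rewrite mul0r mul1r add0r.
apply: is_derive_quotient; apply/cvgrPdist_le => e e0; rewrite near_withinE.
pose C := n%:R * (2 * pi) / r0 ^+ 2 + 1.
have C0 : 0 < C.
  apply: ltr_wpDl => //; apply: divr_ge0; last exact: sqr_ge0.
  by apply: mulr_ge0 => //; exact: ltW.
(* The first bound makes the quotient at most e, the second makes the relative increment h / r0
   admissible for [key], and the last two keep the radius between r1 and r2. *)
pose d := Num.min (Num.min (e / C) (r0 / (n%:R + 1))) (Num.min (r0 - r1) (r2 - r0)).
have n1 : 0 < n%:R + 1 :> R by apply: ltr_wpDl.
have d0 : 0 < d.
  by rewrite !lt_min !subr_gt0 r1r0 r0r2 !andbT; apply/andP; split; exact: divr_gt0.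
apply/nbhs_ballP; exists d => // h; rewrite /ball /= sub0r normrN => hd hn0.
move: hd; rewrite !lt_min => /andP[/andP[hC hn] /andP[hr1 hr2]].
have hE : h + r0 = r0 * (1 + h / r0) by field; rewrite gt_eqF.
have hr : `|h / r0| = `|h| / r0 by rewrite normrM normfV (gtr0_norm r00).
have hn' : (n%:R + 1) * `|h / r0| <= 1.
  rewrite hr mulrA ler_pdivrMr // mul1r; rewrite ltr_pdivlMr // in hn.
  by rewrite mulrC ltW.
have nh : n%:R * `|h / r0| <= 1 by apply: le_trans hn'; rewrite ler_wpM2r // lerDl.
have h1 : `|h / r0| <= 1 by apply: le_trans hn'; rewrite ler_peMl // lerDr.
have rI : r1 < r0 * (1 + h / r0) < r2.
  by rewrite -hE; have := ler_norm h; have := ler_norm (- h); rewrite normrN; lra.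
rewrite sub0r normrN normrM normfV hE mulrC ler_pdivrMr ?normr_gt0 //.
apply: le_trans (key _ nh h1 rI) _.
have -> : n%:R * (h / r0) ^+ 2 * (2 * pi) = (n%:R * (2 * pi) / r0 ^+ 2 * `|h|) * `|h|.
  rewrite -[(h / r0) ^+ 2]real_normK ?num_real // hr; field; rewrite gt_eqF //.
rewrite ler_wpM2r //; rewrite ltr_pdivlMr // mulrC in hC; apply: le_trans (ltW hC).
by rewrite ler_wpM2r // lerDl.
Qed.

Lemma circle_int_const H (r1 r2 r : R) : 0 < r1 -> r1 < 1 -> 1 <= r < r2 ->
  (forall r t, r1 < r < r2 -> quad_diff H (r%:C * cis t)) ->
  circle_int H 1 = circle_int H r.
Proof.
move=> r10 r11 /andP[r_1 rr2] qH; apply: derive0_eq => // u /andP[u1 ur].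
apply: circle_int_derive r10 _ qH.
by rewrite (lt_le_trans r11) // (le_lt_trans ur).
Qed.

End CircleIntegral.

(** * Analytic functions on a Bernstein ellipse *)

Section Continuation.
Local Open Scope complex_scope.
Variable R : realType.
Implicit Types (z w : R[i]) (F H : R[i] -> R[i]) (t u r rho M : R) (f q : R -> R).

Definition joukowski z : R[i] := (z + z^-1) / 2.

Lemma joukowski_polar r (p s : R) : r != 0 -> p ^+ 2 + s ^+ 2 = 1 ->
  joukowski (r%:C * (p +i* s)) = ((r + r^-1) / 2 * p) +i* ((r - r^-1) / 2 * s).
Proof.
move=> r0 ps; rewrite /joukowski.
have -> : (r%:C * (p +i* s))^-1 = r^-1%:C * (p -i* s).
  apply: mulr1_eq; rewrite mulrACA -rmorphM divff // rmorph1 mul1r.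
  simpc; apply/eqP; rewrite eq_complex /=; apply/andP; split; apply/eqP;
    first by rewrite -ps; ring.
  by ring.
have -> : 2 = (2%:R : R)%:C by rewrite rmorph_nat.
rewrite -fmorphV; simpc; apply/eqP; rewrite eq_complex /=.
by apply/andP; split; apply/eqP; field.
Qed.

(** The circle of radius r goes to an ellipse with semi-axes |r + 1/r| / 2 and |r - 1/r| / 2,
    strictly smaller than a and b, also when r < 1. So n = (x/a)^2 + (y/b)^2 < 1, and the point is
    sqrt n times a boundary point. *)
Lemma bernstein_ellipse_mem rho r t : rho^-1 < r < rho -> 1 < rho ->
  bernstein_ellipse rho (joukowski (r%:C * cis t)).
Proof.
move=> /andP[r1 r2] rho1; have rho0 : 0 < rho by exact: lt_trans rho1.
have rhoV0 : 0 < rho^-1 by rewrite invr_gt0.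
have r0 : 0 < r by exact: lt_trans r1.
have rV1 : rho^-1 < r^-1 by rewrite ltf_pV2.
have rV2 : r^-1 < rho by rewrite -[rho]invrK ltf_pV2 // posrE.
have rhoV : rho^-1 < 1 by rewrite invf_lt1.
have rr : r * r^-1 = 1 by rewrite divff // gt_eqF.
have hh : rho * rho^-1 = 1 by rewrite divff // gt_eqF.
rewrite joukowski_polar ?cos2Dsin2 ?gt_eqF //.
set a := (rho + rho^-1) / 2; set b := (rho - rho^-1) / 2.
set x := _ * cos t; set y := _ * sin t.
have a0 : 0 < a by rewrite /a; lra.
have b0 : 0 < b by rewrite /b; lra.
have ar : `|(r + r^-1) / 2| < a.
  rewrite gtr0_norm; last by rewrite divr_gt0 // addr_gt0 // invr_gt0.
  rewrite /a ltr_pM2r ?invr_gt0 // -subr_gt0.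
  have -> : rho + rho^-1 - (r + r^-1) = (rho - r) * (1 - rho^-1 * r^-1).
    rewrite mulrBl mulrBr mulr1;
      have -> : rho * (rho^-1 * r^-1) = r^-1 by rewrite mulrA hh mul1r.
    have -> : r * (1 - rho^-1 * r^-1) = r - rho^-1
      by rewrite mulrBr mulr1 mulrCA rr mulr1.
    by ring.
  rewrite mulr_gt0 ?subr_gt0 // -invfM invf_lt1 ?mulr_gt0 //.
  by rewrite -hh ltr_pM2l // ltr_pV2 // posrE.
have br : `|(r - r^-1) / 2| < b by rewrite ltr_norml /b; apply/andP; split; lra.
pose n := (x / a) ^+ 2 + (y / b) ^+ 2.
have n0 : 0 <= n by rewrite addr_ge0 ?sqr_ge0.
have sqr_lt1 (A c : R) : 0 < c -> `|A| < c -> (A / c) ^+ 2 < 1.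
  move=> c0 Ac; rewrite -[_ ^+ 2]real_normK ?num_real // normrM normfV (gtr0_norm c0).
  by rewrite expr_lt1 // ?ltr_pdivrMr ?mul1r // divr_ge0 // ltW.
have n1 : n < 1.
  have h1 := sqr_lt1 _ _ a0 ar; have h2 := sqr_lt1 _ _ b0 br.
  have cs := cos2Dsin2 t; have c2 := sqr_ge0 (cos t); have s2 := sqr_ge0 (sin t).
  have -> : n = ((r + r^-1) / 2 / a) ^+ 2 * cos t ^+ 2 + ((r - r^-1) / 2 / b) ^+ 2
    * sin t ^+ 2.
    by rewrite /n /x /y -!exprMn; congr (_ ^+ 2 + _ ^+ 2); rewrite mulrAC.
  move: ((_ / a) ^+ 2) ((_ / b) ^+ 2) h1 h2 => A B h1 h2.
  move: (cos t ^+ 2) (sin t ^+ 2) cs c2 s2 => C S cs c2 s2.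
  have : 0 < (1 - A) * C + (1 - B) * S; last by rewrite !mulrBl !mul1r; lra.
  have [C0|C0] := ltP 0 C.
    by apply: ltr_pwDl; [rewrite mulr_gt0 ?subr_gt0|rewrite mulr_ge0 // subr_ge0 ltW].
  apply: ltr_wpDl; first by rewrite mulr_ge0 // subr_ge0 ltW.
  by rewrite mulr_gt0 ?subr_gt0 //; lra.
clearbody x y; pose s := Num.sqrt n; have s0 : 0 <= s by exact: sqrtr_ge0.
have sn : s ^+ 2 = n by rewrite sqr_sqrtr.
have s1 : s < 1 by rewrite -(@sqrtr1 R) ltr_sqrt.
have [p [v [pv xE yE]]] : exists p v : R,
  [/\ p ^+ 2 + v ^+ 2 = 1, x = s * (a * p) & y = s * (b * v)].
  have a1 : a != 0 by rewrite gt_eqF.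
  have b1 : b != 0 by rewrite gt_eqF.
  (* At the centre the direction is undetermined, and any boundary point serves. *)
  have [sz|s_neq0] := eqVneq s 0.
    exists 1, 0; move: sn; rewrite sz expr0n /= => /esym/eqP.
    rewrite paddr_eq0 ?sqr_ge0 // !sqrf_eq0 !mulf_eq0 !invr_eq0 (negPf a1) (negPf b1)
      !orbF.
    by move=> /andP[/eqP -> /eqP ->]; rewrite expr1n addr0 !mul0r.
  exists (x / (a * s)), (y / (b * s)); split;
    [|by field; rewrite s_neq0 a1|by field; rewrite s_neq0 b1].
  have -> : (x / (a * s)) ^+ 2 + (y / (b * s)) ^+ 2 = n / s ^+ 2.
    by rewrite /n; field; rewrite s_neq0 a1 b1.
  by rewrite -sn divff // expf_neq0.
exists s; first by rewrite s0.
exists (rho%:C * (p +i* v)).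
  by rewrite normc_normr normcM normc_real gtr0_norm // /normc pv sqrtr1 mulr1.
rewrite -[X in _ = _ * X]/(joukowski _) joukowski_polar ?gt_eqF // -/a -/b xE yE.
by simpc.
Qed.

Lemma analytic_quad_diff (U : set R[i]) F z0 : analytic_on U F -> U z0 ->
  quad_diff F z0.
Proof.
move=> aF /aF[rc rc0 [c Fc]].
(* A positive element of R[i] is real, so the complex radius [rc] is an ordinary one. *)
have rE : rc = (complex.Re rc)%:C by rewrite RRe_real // gtr0_real.
have r0 : 0 < complex.Re rc by move: rc0; rewrite ltcE => /andP[].
apply: (power_series_quad_diff r0 (c := c)) => z zr e e0.
have /Fc : `|z - z0| < rc by rewrite rE normc_normr ltcR.
move=> /cvgrPdist_le /(_ e%:C); rewrite ltcR => /(_ e0) [N _ HN].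
by exists N => n /HN /=; rewrite normc_normr lecR.
Qed.

Lemma cisX t (k : nat) : cis t ^+ k = cis (k%:R * t).
Proof.
elim: k => [|k IH]; first by rewrite expr0 mul0r /cis cos0 sin0.
by rewrite exprSr IH -cisD -natr1 mulrDl mul1r.
Qed.

Lemma cisV t : (cis t)^-1 = cis (- t).
Proof. by apply: mulr1_eq; rewrite -cisD subrr /cis cos0 sin0. Qed.

(** Evenness and periodicity give q(2 pi - u) = q(u), so G(u) + G(2 pi - u) is constant on
    [0, pi]. *)
Lemma segint_even_periodic q : continuous q -> (forall t, q (t + 2 * pi) = q t) ->
  (forall t, q (- t) = q t) -> segint 0 (2 * pi) q = 2 * segint 0 pi q.
Proof.
move=> cq qp qe; have pi0 := pi_gt0 R.
have [G dG] := antiderivative_exists (2 * pi + 1) cq.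
have dG' t : -1 < t < 2 * pi + 1 -> is_derive t 1 G (q t).
  by move=> /andP[t1 t2]; apply: dG; rewrite ltr_norml; lra.
have dG0 t : 0 <= t <= 2 * pi -> is_derive t 1 G (q t).
  by move=> /andP[t1 t2]; apply: dG'; lra.
have dG1 t : 0 <= t <= pi -> is_derive t 1 G (q t).
  by move=> /andP[t1 t2]; apply: dG'; lra.
rewrite (segint_FTC _ cq dG0) ?mulr_gt0 // (segint_FTC pi0 cq dG1).
pose K u := G u + G (2 * pi - 1 * u).
have dK u : 0 <= u <= pi -> is_derive u 1 K 0.
  move=> uI; have qu : q (2 * pi - 1 * u) = q u by rewrite mul1r addrC qp qe.
  have -> : 0 = q u + q (2 * pi - 1 * u) * (0 - 1) by rewrite qu; ring.
  apply: is_derive_add; first exact: dG1.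
  apply: (is_derive_comp (g := fun u => 2 * pi - 1 * u)).
    by apply: dG0; rewrite mul1r; lra.
  exact: is_derive_sub (is_derive_cst _ _ _) (is_derive_linear _ _).
have := derive0_eq (ltW pi0) dK.
have -> : K 0 = G 0 + G (2 * pi) by rewrite /K mulr0 subr0.
have -> : K pi = G pi + G pi.
  rewrite /K; have -> // : 2 * pi - 1 * pi = pi :> R
    by rewrite mul1r mulr_natl mulr2n addrK.
lra.
Qed.

Let le_of_double (x m l p : R) : 2 * x <= m * l * (2 * p) -> x <= m * p * l.
Proof. lra. Qed.

Let mul_div_cancel (m x p : R) : 0 < p -> 2 * m * x = 2 / p * (m * p * x).
Proof. by move=> p0; field; rewrite gt_eqF. Qed.

Section Coefficients.
Variables (rho M : R) (f : R -> R) (F : R[i] -> R[i]).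
Hypothesis rho1 : 1 < rho.
Hypothesis aF : analytic_on (bernstein_ellipse rho) F.
Hypothesis Ff : {in `[-1, 1], forall x, F x%:C = (f x)%:C}.
Hypothesis FM : forall w, bernstein_ellipse rho w -> `|F w| <= M%:C.

Let rho0 : 0 < rho. Proof. exact: lt_trans rho1. Qed.
Let rhoV1 : rho^-1 < 1. Proof. by rewrite invf_lt1. Qed.

(** The negative power has modulus r^-k on the circle of radius r, so that enlarging the circle
    improves the bound. F o joukowski is analytic on the annulus 1/rho < |z| < rho. *)
Definition laurent (k : nat) z : R[i] := F (joukowski z) * z^-1 ^+ k.

Lemma quad_diff_laurent k r t : rho^-1 < r < rho ->
  quad_diff (laurent k) (r%:C * cis t).
Proof.
move=> rI; have r0 : 0 < r by case/andP: rI => + _; apply: lt_trans; rewrite invr_gt0.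
have z0 : r%:C * cis t != 0.
  apply/eqP => /(congr1 (@normc R)); rewrite normcM normc_cis normc_real normc0 mulr1.
  by move/eqP; rewrite normr_eq0 gt_eqF.
apply: quad_diff_mul.
  apply: quad_diff_comp; last exact: analytic_quad_diff aF
    (bernstein_ellipse_mem t rI rho1).
  rewrite /joukowski; apply: quad_diff_mul; last exact: quad_diff_const.
  by apply: quad_diff_add; [exact: quad_diff_id|exact: quad_diff_inv].
elim: k => [|k IH]; first exact: quad_diff_const.
under eq_fun do rewrite exprS.
by apply: quad_diff_mul => //; exact: quad_diff_inv.
Qed.

Lemma joukowski_cis t : joukowski (cis t) = (cos t)%:C.
Proof.
have := @joukowski_polar 1 (cos t) (sin t) (oner_neq0 R) (cos2Dsin2 t).
by rewrite rmorph1 mul1r invr1 subrr mul0r mul0r -[1 + 1]/2 divff ?pnatr_eq0 // mul1r =>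
  ->.
Qed.

Lemma laurent_cis k t : laurent k (cis t)
  = (f (cos t) * cos (k%:R * t)) -i* (f (cos t) * sin (k%:R * t)).
Proof.
rewrite /laurent joukowski_cis Ff ?cos_itv // cisV cisX mulrN /cis cosN sinN.
by simpc.
Qed.

Lemma continuation_continuous_cos : continuous (fun t => f (cos t)).
Proof.
have -> : (fun t => f (cos t)) = (fun t => complex.Re (laurent 0 (1%:C * cis t))).
  by apply/funext => t; rewrite mul1r laurent_cis /= mul0r cos0 mulr1.
apply: continuous_circle; [exact: ReB|exact: normc_Re_le|exact: ltr01|].
by move=> t; apply: quad_diff_laurent; rewrite rhoV1.
Qed.

Lemma cos_coef_continuation_le k :
  `|cos_coef (fun t => f (cos t)) k| <= 2 * M * rho^-1 ^+ k.
Proof.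
have pi0 := pi_gt0 R; have p0 : 0 < 2 * pi :> R by rewrite mulr_gt0.
pose q t := f (cos t) * cos (k%:R * t).
have cq : continuous q.
  by apply: continuous_mul; [exact: continuation_continuous_cos|exact: continuous_cosM].
have cI : circle_int (laurent k) 1 = 2 * segint 0 pi q.
  rewrite -segint_even_periodic //.
  - by apply: eq_segint => t _; rewrite mul1r laurent_cis.
  - move=> t; rewrite /q mulr_natl mulr2n addrA !cosDpi opprK; congr (_ * _).
    have := congr1 (@complex.Re R) (cisX (t + pi + pi) k).
    have -> : cis (t + pi + pi) = cis t by rewrite /cis !cosDpi !sinDpi !opprK.
    by rewrite cisX /= => <-.
  - by move=> t; rewrite /q cosN mulrN cosN.
have bound r : 1 <= r < rho -> `|segint 0 pi q| <= M * pi * r^-1 ^+ k.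
  move=> rI; have r0 : 0 < r by case/andP: rI => + _; exact: lt_le_trans.
  have rk0 : 0 <= r^-1 ^+ k by apply: exprn_ge0; rewrite invr_ge0; exact: ltW r0.
  have rI' : rho^-1 < r < rho.
    by case/andP: rI => rl ->; rewrite (lt_le_trans rhoV1).
  have rhoV0 : 0 < rho^-1 by rewrite invr_gt0.
  have E := circle_int_const rhoV0 rhoV1 rI (@quad_diff_laurent k).
  have : `|circle_int (laurent k) r| <= M * r^-1 ^+ k * (2 * pi).
    have -> : M * r^-1 ^+ k * (2 * pi) = M * r^-1 ^+ k * (2 * pi - 0) by rewrite subr0.
    apply: segint_norm_le; first exact: ltW.
      apply: continuous_circle; [exact: ReB|exact: normc_Re_le|exact: r0|].
      by move=> t; exact: quad_diff_laurent.
    move=> t _; apply: le_trans (normc_Re_le _) _;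
      rewrite /laurent normcM normcX normcV.
    have -> : normc (r%:C * cis t) = r.
      by rewrite normcM normc_cis normc_real mulr1 (gtr0_norm r0).
    have FMr : normc (F (joukowski (r%:C * cis t))) <= M.
      by have := FM (bernstein_ellipse_mem t rI' rho1); rewrite normc_normr lecR.
    exact: (ler_wpM2r rk0 FMr).
  have I2 : `|2 * segint 0 pi q| = 2 * `|segint 0 pi q| by rewrite normrM normr_nat.
  by rewrite -E cI I2; exact: le_of_double.
(* F is controlled on the open ellipse only, hence for r < rho; the value at rho follows by letting
   r tend to rho from the left. *)
have limit : `|segint 0 pi q| <= M * pi * rho^-1 ^+ k.
  rewrite exprVn ler_pdivlMr ?exprn_gt0 //.
  have cv : `|segint 0 pi q| * r ^+ k @[r --> rho^'-] --> `|segint 0 pi q| * rho ^+ k.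
    apply: cvgM; first exact: cvg_cst.
    by apply: cvg_at_left_filter; exact: exprn_continuous.
  rewrite -(cvg_lim _ cv) //; apply: limr_le; first by apply/cvg_ex; eexists; exact: cv.
  near=> r; have rI : 1 <= r < rho.
    by apply/andP; split=> //; near: r; exact: nbhs_left_ge.
  have r0 : 0 < r by case/andP: rI => + _; exact: lt_le_trans.
  by have := bound r rI; rewrite exprVn ler_pdivlMr // exprn_gt0.
rewrite /cos_coef normrM.
have -> : 2 * M * rho^-1 ^+ k = 2 / pi * (M * pi * rho^-1 ^+ k).
  exact: mul_div_cancel.
apply: ler_pM => //; rewrite normrM normfV (gtr0_norm pi0).
rewrite ler_wpM2r ?invr_ge0 ?(ltW pi0) //.
by case: (k == 0%N); rewrite ?normr1 ?ler1n // normr_nat.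
Unshelve. all: by end_near. Qed.

End Coefficients.
End Continuation.

(** * The two estimates *)

Section Final.
Local Open Scope complex_scope.
Variable R : realType.
Implicit Types (f : R -> R) (rho M V B : R).

Lemma within_continuous_modulus f :
  (forall x, x \in `[-1, 1] -> forall e, 0 < e -> exists2 d, 0 < d &
     forall y, y \in `[-1, 1] -> `|x - y| < d -> `|f x - f y| <= e) ->
  {within `[-1, 1], continuous f}.
Proof.
move=> fc; apply/subspace_continuousP => x xI; apply/cvgrPdist_le => e e0.
have [d d0 fd] := fc x xI e e0.
rewrite near_withinE; apply/nbhs_ballP; exists d => // y xy yI.
by apply: fd => //; exact: yI.
Qed.

Lemma absolutely_continuous_within f : absolutely_continuous_on `[-1, 1] f ->
  {within `[-1, 1], continuous f}.
Proof.
move=> acf; apply: within_continuous_modulus => x xI e e0.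
have [d d0 fd] := absolutely_continuous_uniform acf e0.
by exists d => // y yI xy; apply/ltW/fd.
Qed.

Lemma bv_smooth_within nu V f : bv_smooth nu V f -> {within `[-1, 1], continuous f}.
Proof. by move=> /bv_smooth_absolutely_continuous;
  exact: absolutely_continuous_within. Qed.

(** A point x of the segment is the Joukowski image of [cis (acos x)], so it lies in the ellipse,
    where F is locally Lipschitz. *)
Lemma continuation_within rho M f : 1 < rho -> bounded_analytic_continuation rho M f ->
  {within `[-1, 1], continuous f}.
Proof.
move=> rho1 [F [aF Ff _]]; apply: within_continuous_modulus => x xI e e0.
have x11 : -1 <= x <= 1 by move: xI; rewrite in_itv.
have rhoV : rho^-1 < 1 by rewrite invf_lt1 // (lt_trans ltr01).
have : bernstein_ellipse rho (joukowski (1%:C * cis (acos x))).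
  by apply: bernstein_ellipse_mem => //; rewrite rhoV.
rewrite mul1r joukowski_cis acosK // => /(analytic_quad_diff aF)/quad_diff_lipschitz.
move=> [d [L [d0 L0 FL]]]; have L1 : 0 < L + 1 by rewrite ltr_wpDl.
have k0 : 0 < Num.min d (e / (L + 1)) by rewrite lt_min d0 divr_gt0.
exists (Num.min d (e / (L + 1))) => // y yI; rewrite lt_min => /andP[xyd xye].
have nxy (a b : R) : normc (a%:C - b%:C) = `|a - b| by rewrite -rmorphB normc_real.
rewrite -nxy -!Ff //; apply: le_trans (FL _ _ _ _) _; rewrite nxy ?subrr ?normr0 //.
  by rewrite distrC.
rewrite ltr_pdivlMr // in xye; have := normr_ge0 (x - y); nra.
Qed.

Lemma continuation_cos_series rho M f (j : nat) : 1 < rho -> 0 < M ->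
  bounded_analytic_continuation rho M f -> forall t, 0 <= t <= pi ->
  `|f (cos t) - \sum_(k < j) cos_coef (fun t => f (cos t)) k * cos (k%:R * t)|
    <= 2 * M * rho ^ (- j%:Z + 1) / (rho - 1).
Proof.
move=> rho1 M0 [F [aF Ff FM]]; have rho0 : 0 < rho by exact: lt_trans rho1.
apply: cos_series_tail; first exact: (continuation_continuous_cos rho1 aF Ff).
move=> N; apply: (@le_trans _ _ (\sum_(j <= k < N) 2 * M * rho^-1 ^+ k)).
  by apply: ler_sum => k _; exact: (cos_coef_continuation_le rho1 aF Ff FM).
rewrite -mulr_sumr -!mulrA ler_wpM2l // ler_wpM2l ?(ltW M0) //.
have -> : rho ^ (- j%:Z + 1) = rho^-1 ^+ j * rho.
  by rewrite expfzDr ?gt_eqF // expr1z -exprnN exprVn.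
(* Up to sign, the full geometric tail from k on; the sum telescopes. *)
pose w k : R := - (rho^-1 ^+ k * rho / (rho - 1)).
have r1 : rho - 1 != 0 by rewrite subr_eq0 gt_eqF.
have w_ge0 k : 0 <= rho^-1 ^+ k * rho / (rho - 1).
  by rewrite divr_ge0 ?mulr_ge0 ?exprn_ge0 ?invr_ge0 ?subr_ge0 // ltW.
have [Nj|/ltnW jN] := leqP N j; first by rewrite big_geq.
rewrite (telescope_sumr_eq w) //; last first.
  move=> k _; rewrite /w exprS; move: (rho^-1 ^+ k) => u; field.
  by rewrite r1 gt_eqF.
by rewrite /w opprK addrC lerBlDr lerDl.
Qed.

Lemma singular_values_le_cos_series d L (phi : 'I_d -> R -> R) (x : 'I_L -> R)
    (s sigma : 'I_d -> R) (j : 'I_d) B : 0 <= B ->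
  (forall l, x l \in `[-1, 1]) ->
  (forall i, {within `[-1, 1], continuous phi i}) ->
  quasimatrix_singular_values phi s ->
  matrix_singular_values (\matrix_(i < d, l < L) phi i (x l)) sigma ->
  (forall i t, 0 <= t <= pi ->
    `|phi i (cos t) - \sum_(k < j) cos_coef (fun t => phi i (cos t)) k * cos (k%:R * t)|
      <= B) ->
  s j <= 2 * Num.sqrt d%:R * B /\ sigma j <= Num.sqrt (d * L)%:R * B.
Proof.
move=> B0 xI cphi ss ssig phiB.
pose P : 'M[R]_(d, j) := \matrix_(i, k) cos_coef (fun t => phi i (cos t)) k.
(* On [-1, 1] this is the Chebyshev polynomial of degree k. There are j of them, so the rank m
   equals j and the bound applies to index j itself. *)
pose T (k : 'I_j) y : R := cos (k%:R * acos y).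
have approx i y : y \in `[-1, 1] -> `|phi i y - \sum_k P i k * T k y| <= B.
  rewrite in_itv /= => yI; have := phiB i (acos y); rewrite acosK ?in_itv //.
  have -> : \sum_k P i k * T k y =
      \sum_(k < j) cos_coef (fun t => phi i (cos t)) k * cos (k%:R * acos y).
    by apply: eq_bigr => k _; rewrite mxE.
  by apply; rewrite acos_ge0 // acos_lepi.
split.
  exact: (quasimatrix_singular_values_le approx B0 cphi ss (leqnn j)).
exact: (matrix_singular_values_le approx B0 xI ssig (leqnn j)).
Qed.

End Final.

(** * The implied constants *)

Section Constants.
Variable R : realType.

Lemma shift_gt0 (nu j : nat) : (nu + 1 < j)%N -> 0 < j%:R - 1 - nu%:R :> R.
Proof. by move=> nuj; rewrite -addrA -opprD subr_gt0 addrC natr1 ltr_nat -addn1. Qed.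

(** With m + 1 = j - 1 - nu >= 1, one has j = (m + 1) + (nu + 1) <= (nu + 2)(m + 1); this is the
    source of the constant (nu + 2)^nu. *)
Lemma inv_shift_le (nu j : nat) : (nu + 1 < j)%N ->
  ((j%:R - 1 - nu%:R) ^+ nu)^-1 <= (nu.+2%:R ^+ nu) * j%:R ^- nu :> R.
Proof.
move=> nuj.
have j0 : (0 < j)%N by exact: leq_ltn_trans nuj.
have [m jE] : exists m, j = (m.+1 + nu + 1)%N by exists (j - nu - 2)%N; lia.
have mE : j%:R - 1 - nu%:R = m.+1%:R :> R by rewrite jE !natrD; ring.
rewrite mE -!exprVn -exprMn.
have h : m.+1%:R^-1 <= nu.+2%:R * j%:R^-1 :> R.
  rewrite ler_pdivlMr ?ltr0n // mulrC ler_pdivrMr ?ltr0n // -natrM ler_nat jE; nia.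
by apply: lerXn2r h; rewrite nnegrE ?mulr_ge0 ?invr_ge0.
Qed.

End Constants.

(* Indices are 0-based: for j : 'I_d, [s j] is s_{j+1}. The constants C, C' are
   the implied constants of the O-notations. *)
Theorem theorem1 (R : realType) :
  (forall (V : R) (nu : nat), 0 < V -> (1 <= nu)%N ->
    exists C C' : R,
    forall (d : nat) (phi : 'I_d -> R -> R) (L : nat) (x : 'I_L -> R)
      (s sigma : 'I_d -> R),
    (1 < d)%N ->
    (forall l, x l \in `[-1, 1]) ->
    quasimatrix_singular_values phi s ->
    matrix_singular_values (\matrix_(i < d, l < L) phi i (x l)) sigma ->
    (forall i, bv_smooth nu V (phi i)) ->
    forall j : 'I_d, (nu + 1 < j)%N ->
      s j <= 4 * V * Num.sqrt d%:R
             / (pi * nu%:R * (j%:R - 1 - nu%:R) ^+ nu)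
          <= C * (j%:R ^- nu * Num.sqrt d%:R) /\
      sigma j <= 2 * V * Num.sqrt (d * L)%:R
                 / (pi * nu%:R * (j%:R - 1 - nu%:R) ^+ nu)
              <= C' * (j%:R ^- nu * Num.sqrt (d * L)%:R))
  /\
  (forall M rho : R, 0 < M -> 1 < rho ->
    exists C C' : R,
    forall (d : nat) (phi : 'I_d -> R -> R) (L : nat) (x : 'I_L -> R)
      (s sigma : 'I_d -> R),
    (1 < d)%N ->
    (forall l, x l \in `[-1, 1]) ->
    quasimatrix_singular_values phi s ->
    matrix_singular_values (\matrix_(i < d, l < L) phi i (x l)) sigma ->
    (forall i, bounded_analytic_continuation rho M (phi i)) ->
    forall j : 'I_d,
      s j <= 4 * M * Num.sqrt d%:R * rho ^ (- j%:Z + 1) / (rho - 1)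
          <= C * (rho ^ (- j%:Z) * Num.sqrt d%:R) /\
      sigma j <= 2 * M * Num.sqrt (d * L)%:R * rho ^ (- j%:Z + 1) / (rho - 1)
              <= C' * (rho ^ (- j%:Z) * Num.sqrt (d * L)%:R)).

Proof.
split.
  move=> V nu V0 nu0.
  have nuR : 0 < nu%:R :> R by rewrite ltr0n.
  have p0 := pi_gt0 R.
  (* The explicit bounds with (j - 1 - nu)^-nu replaced by (nu + 2)^nu j^-nu. *)
  exists (4 * V / (pi * nu%:R) * nu.+2%:R ^+ nu),
    (2 * V / (pi * nu%:R) * nu.+2%:R ^+ nu).
  move=> d phi L x s sigma _ xI ss ssig bv j nuj.
  pose D : R := (j%:R - 1 - nu%:R) ^+ nu.
  have D0 : 0 < D by rewrite exprn_gt0 // shift_gt0.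
  pose B := 2 * V / (pi * nu%:R * D).
  have B0 : 0 <= B by rewrite divr_ge0 ?mulr_ge0 // ltW.
  have cphi i : {within `[-1, 1], continuous phi i} by exact: bv_smooth_within (bv i).
  have phiB i t : 0 <= t <= pi ->
      `|phi i (cos t) - \sum_(k < j) cos_coef (fun t => phi i (cos t)) k
        * cos (k%:R * t)| <= B.
    by move=> tI; apply: bv_smooth_cos_series tI => //;
      [rewrite addn1 in nuj|exact: ltW].
  have [s1 s2] := singular_values_le_cos_series B0 xI cphi ss ssig phiB.
  have c := inv_shift_le R nuj; rewrite -/D in c *.
  have aux (a q : R) : 0 <= a -> 0 <= q -> a * V * q / (pi * nu%:R * D)
      <= a * V / (pi * nu%:R) * nu.+2%:R ^+ nu * (j%:R ^- nu * q).
    move=> a0 q0; have k0 : 0 <= a * V / (pi * nu%:R) * q.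
      by rewrite mulr_ge0 // divr_ge0 ?mulr_ge0 // ltW.
    have h := ler_wpM2l k0 c.
    have -> : a * V * q / (pi * nu%:R * D) = a * V / (pi * nu%:R) * q * D^-1.
      by rewrite [(_ * D)^-1]invfM; move: (pi * nu%:R)^-1 D^-1 => K E; ring.
    apply: le_trans h _; rewrite le_eqVlt; apply/orP; left; apply/eqP.
    by move: (pi * nu%:R)^-1 => K; ring.
  split; apply/andP; split.
  - apply: le_trans s1 _; rewrite /B le_eqVlt; apply/orP; left; apply/eqP.
    by move: (_^-1) => K; ring.
  - exact/aux/sqrtr_ge0.
  - apply: le_trans s2 _; rewrite /B le_eqVlt; apply/orP; left; apply/eqP.
    by move: (_^-1) => K; ring.
  - exact/aux/sqrtr_ge0.
(* The second inequalities are equalities here, since rho^(-j+1) = rho^-j rho. *)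
move=> M rho M0 rho1; exists (4 * M * rho / (rho - 1)), (2 * M * rho / (rho - 1)).
move=> d phi L x s sigma _ xI ss ssig ac j; have rho0 : 0 < rho by exact: lt_trans rho1.
pose B := 2 * M * rho ^ (- j%:Z + 1) / (rho - 1).
have B0 : 0 <= B.
  by rewrite divr_ge0 ?mulr_ge0 ?exprz_ge0 ?subr_ge0 // ltW.
have cphi i : {within `[-1, 1], continuous phi i} by exact: continuation_within (ac i).
have phiB i t : 0 <= t <= pi ->
    `|phi i (cos t) - \sum_(k < j) cos_coef (fun t => phi i (cos t)) k * cos (k%:R * t)|
      <= B.
  exact: (continuation_cos_series j rho1 M0 (ac i)).
have [s1 s2] := singular_values_le_cos_series B0 xI cphi ss ssig phiB.
have rE : rho ^ (- j%:Z + 1) = rho ^ (- j%:Z) * rho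
  by rewrite expfzDr ?gt_eqF // expr1z.
rewrite rE; rewrite /B rE in s1 s2.
split; apply/andP; split.
- by apply: le_trans s1 _; rewrite le_eqVlt; apply/orP; left; apply/eqP; ring.
- by rewrite le_eqVlt; apply/orP; left; apply/eqP; ring.
- by apply: le_trans s2 _; rewrite le_eqVlt; apply/orP; left; apply/eqP; ring.
- by rewrite le_eqVlt; apply/orP; left; apply/eqP; ring.
Qed.
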